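(* Let $0<\alpha<1/2$, let $m$ be a positive integer, and let $G$ be a graph on $n\ge 10^8 m\alpha^{-5}$ vertices. If $\mathcal{P}$ is a vertex partition of $G$ into $m$ parts, then there is an equitable vertex partition $\mathcal{Q}$ of $G$ into at most $4m/\alpha$ parts such that $\operatorname{irreg}(\mathcal{Q})\le\operatorname{irreg}(\mathcal{P})+\alpha n^2$.
   Context: For vertex subsets $X,Y$ (not necessarily disjoint) of a graph, $e(X,Y)$ is the number of pairs $(x,y)\in X\times Y$ that are edges and $d(X,Y)=e(X,Y)/(|X||Y|)$. The irregularity of $(X,Y)$ is $\operatorname{irreg}(X,Y)=\max_{U\subseteq X,W\subseteq Y}|e(U,W)-|U||W|d(X,Y)|$, and the irregularity of a vertex partition $\mathcal{P}$ is $\operatorname{irreg}(\mathcal{P})=\sum_{X,Y\in\mathcal{P}}\operatorname{irreg}(X,Y)$ (sum over all ordered pairs of parts). A partition is equitable if any two parts differ in size by at most one. *)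

(* Defs.v *)
From mathcomp Require Import all_boot all_order all_algebra.
From mathcomp Require Import reals.

Set Implicit Arguments.
Unset Strict Implicit.
Unset Printing Implicit Defensive.

Import Order.TTheory GRing.Theory Num.Theory.
Local Open Scope ring_scope.

Section Irregularity.
Variables (R : realType) (T : finType) (adj : rel T).
Implicit Types (X Y U W : {set T}) (P : {set {set T}}).

(* Ordered pairs: an edge inside X :&: Y is counted twice. *)
Definition edge_count X Y : nat :=
  #|[set p in setX X Y | adj p.1 p.2]|.

Definition density X Y : R :=
  (edge_count X Y)%:R / (#|X|%:R * #|Y|%:R).

(* The maximum runs over a nonempty family of nonnegative reals, so the
   default value 0 does not affect it. *)
Definition irreg X Y : R :=
  \big[Num.max/0]_(UW : {set T} * {set T}
                   | (UW.1 \subset X) && (UW.2 \subset Y))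
    `| (edge_count UW.1 UW.2)%:R - #|UW.1|%:R * #|UW.2|%:R * density X Y |.

Definition irreg_partition P : R :=
  \sum_(X in P) \sum_(Y in P) irreg X Y.

End Irregularity.

Definition equitable (T : finType) (P : {set {set T}}) : Prop :=
  forall X Y : {set T}, X \in P -> Y \in P -> (#|X| <= #|Y| + 1)%N.

(* Main.v *)
Require Import Defs.
From mathcomp Require Import all_boot all_order all_algebra all_fingroup.
From mathcomp Require Import reals ring lra.

(** Cut every part of P into pieces of equal size k ~ n / K with K ~ 4m / alpha,
    collect the remainders into at most m further pieces, and attach the fewer than
    K vertices still left over to distinct pieces.  Then apply a uniformly random
    permutation preserving every part of P.

    Pairs involving a remainder piece, and pairs of equal pieces, are controlled by
    irreg (X, Y) <= |X||Y| / 4.  For the other pairs, inside X x Y say, put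
    a := adj - d(X, Y).  The irregularity of (C, D) is at most the cut norm of a on
    C x D plus |a(C, D)|.  The second term is small by a second moment computation.
    For the first one, write the cut norm as the maximum over a sign and a set W of
    sum_(x in C) (+- a(x, W))^+.  Swapping C with another piece C' point by point
    preserves the distribution, so the expected maximum of the difference of the
    sums over C and C' is a Rademacher average; the contraction principle removes
    the positive part, after which the maximum is at most
    sum_y |sum_x eps_x a(x, y)|, of expectation O(|D| sqrt k).  Averaging over C'
    and doing the same for columns shows that the expected cut norms on pairs of
    pieces sum to at most the cut norm on X x Y, plus O(|X||Y| / sqrt k). *)

Set Implicit Arguments.
Unset Strict Implicit.
Unset Printing Implicit Defensive.

Import Order.TTheory GRing.Theory Num.Theory.
Local Open Scope ring_scope.

(** * Maxima of real functions over a finite index type *)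

Section Maximum.
Variables (R : realDomainType) (I : finType) (t0 : I).

(** Taken as the value at an arg max rather than as an iterated maximum: no default value enters,
    negative values are allowed, and the maximum is attained. The point [t0] only witnesses that [I]
    is inhabited. *)
Definition maxf (F : I -> R) : R := F [arg max_(t > t0) F t]%O.

Lemma maxf_ge F t : F t <= maxf F.
Proof. by rewrite /maxf; case: arg_maxP => // i _; apply. Qed.

Lemma maxf_le F c : (forall t, F t <= c) -> maxf F <= c.
Proof. by move=> h; apply: h. Qed.

Lemma maxf_ex F : exists t, maxf F = F t.
Proof. by eexists. Qed.

Lemma eq_maxf F F' : F =1 F' -> maxf F = maxf F'.
Proof.
move=> e; apply/eqP; rewrite eq_le; apply/andP; split; apply: maxf_le => t.
  by rewrite e maxf_ge.
by rewrite -e maxf_ge.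
Qed.

End Maximum.

(** * Rademacher averages *)

Section Rademacher.
Variables (R : rcfType) (T : finType).
Implicit Types (e : {ffun T -> bool}) (x : T).

Definition sgn e x : R := (-1) ^+ e x.

Definition flip x e : {ffun T -> bool} := [ffun y => (y == x) (+) e y].

Lemma flipK x : involutive (flip x).
Proof. by move=> e; apply/ffunP=> y; rewrite !ffunE addKb. Qed.

Lemma sgn_flip e x : sgn (flip x e) x = - sgn e x.
Proof. by rewrite /sgn ffunE eqxx; case: (e x); rewrite /= ?expr0 ?expr1 ?opprK. Qed.

Lemma sgn_flip_neq e x y : y != x -> sgn (flip x e) y = sgn e y.
Proof. by rewrite /sgn ffunE => /negbTE ->. Qed.

Lemma sum_flip (F : {ffun T -> bool} -> R) x : \sum_e F (flip x e) = \sum_e F e.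
Proof. by rewrite [RHS](reindex_inj (inv_inj (flipK x))). Qed.

Lemma sgn_sqr e x : sgn e x ^+ 2 = 1.
Proof. by rewrite /sgn sqrr_sign. Qed.

Lemma sum_sgn_mul x y :
  \sum_e sgn e x * sgn e y = #|{ffun T -> bool}|%:R * (x == y)%:R.
Proof.
case: eqVneq => [->|nxy]; rewrite ?mulr1 ?mulr0.
  by under eq_bigr do rewrite -expr2 sgn_sqr; rewrite sumr_const.
have : \sum_e sgn e x * sgn e y = - \sum_e sgn e x * sgn e y.
  rewrite -{1}(sum_flip _ x) -sumrN; apply: eq_bigr => e _.
  by rewrite sgn_flip sgn_flip_neq 1?eq_sym// mulNr.
by lra.
Qed.

(** Expand [(|z| - l)^2 >= 0]. This replaces Cauchy-Schwarz for averages: if the second moment is at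
    most [l ^+ 2], the right-hand side averages to at most [l]. *)
Lemma abs_le_sqr (z l : R) : 0 < l -> `|z| <= (z ^+ 2 / l + l) / 2%:R.
Proof.
move=> l0; rewrite -(ler_pM2r l0) -real_normK ?num_real//.
have -> : (`|z| ^+ 2 / l + l) / 2%:R * l = (`|z| ^+ 2 + l ^+ 2) / 2%:R.
  by field; lra.
by have := sqr_ge0 (`|z| - l); nra.
Qed.

(** The signs are orthogonal, so the second moment of the signed sum is [\sum_x v x ^+ 2], and
    [abs_le_sqr] passes to the first moment. Sums over [e] stay unnormalised, whence the factor
    counting sign vectors. *)
Lemma rademacher_L1 (v : T -> R) (l : R) : 0 < l ->
  \sum_x v x ^+ 2 <= l ^+ 2 ->
  \sum_e `|\sum_x sgn e x * v x| <= #|{ffun T -> bool}|%:R * l.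
Proof.
move=> l0 hv.
have E2 : \sum_e (\sum_x sgn e x * v x) ^+ 2
    = #|{ffun T -> bool}|%:R * \sum_x v x ^+ 2.
  under eq_bigr => e _ do rewrite expr2 mulr_suml.
  rewrite exchange_big mulr_sumr; apply: eq_bigr => x _.
  under eq_bigr => e _ do rewrite mulr_sumr.
  rewrite exchange_big /= (bigD1 x)//= [X in _ + X]big1 ?addr0 => [|y nyx].
    under eq_bigr => e _ do rewrite mulrACA.
    by rewrite -mulr_suml sum_sgn_mul eqxx mulr1 expr2.
  under eq_bigr => e _ do rewrite mulrACA.
  by rewrite -mulr_suml sum_sgn_mul eq_sym (negbTE nyx) mulr0 mul0r.
apply: (@le_trans _ _
  (\sum_e ((\sum_x sgn e x * v x) ^+ 2 / l + l) / 2%:R)).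
  by apply: ler_sum => e _; apply: abs_le_sqr.
rewrite -mulr_suml big_split /= -mulr_suml E2 sumr_const -[l *+ _]mulr_natl.
set N := #|_|%:R; have N0 : 0 <= N by rewrite ler0n.
rewrite ler_pdivrMr// -mulrA -mulrDr -mulrA ler_wpM2l//.
have : (\sum_x v x ^+ 2) / l <= l by rewrite ler_pdivrMr.
by lra.
Qed.

Section Contraction.
Variables (I : finType) (t0 : I).

(** Pair [e] with [flip x0 e]. If [t] and [u] attain the two maxima for [h], their sum is
    [A t + A u] plus or minus [h t x0 - h u x0]. This is at most [A t + A u + |h' t x0 - h' u x0|],
    which is attained for [h'] by [t] and [u], in one order or the other. *)
Lemma contraction_step (h h' : I -> T -> R) x0 :
  (forall t x, x != x0 -> h t x = h' t x) ->
  (forall t u, `|h t x0 - h u x0| <= `|h' t x0 - h' u x0|) ->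
  \sum_e maxf t0 (fun t => \sum_x sgn e x * h t x)
    <= \sum_e maxf t0 (fun t => \sum_x sgn e x * h' t x).
Proof.
move=> hE hL.
pose M k e := maxf t0 (fun t => \sum_x sgn e x * (k t x : R)).
suff key e : M h e + M h (flip x0 e) <= M h' e + M h' (flip x0 e).
  have : \sum_e (M h e + M h (flip x0 e)) <= \sum_e (M h' e + M h' (flip x0 e)).
    by apply: ler_sum.
  by rewrite !big_split /= !(sum_flip (M _)); rewrite /M; lra.
pose A t := \sum_(x | x != x0) sgn e x * h t x.
have E k t : (forall x, x != x0 -> h t x = k t x) ->
    \sum_x sgn e x * k t x = A t + sgn e x0 * k t x0 /\
    \sum_x sgn (flip x0 e) x * k t x = A t - sgn e x0 * k t x0.
  move=> hk; split; rewrite (bigD1 x0)//= addrC.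
    by congr (_ + _); apply: eq_bigr => x nx; rewrite hk.
  rewrite sgn_flip mulNr; congr (_ - _).
  by apply: eq_bigr => x nx; rewrite sgn_flip_neq ?hk.
have [t ht] := maxf_ex t0 (fun t => \sum_x sgn e x * h t x).
have [u hu] := maxf_ex t0 (fun t => \sum_x sgn (flip x0 e) x * h t x).
rewrite {1 2}/M ht hu.
have [-> _] := E h t (fun _ _ => erefl).
have [_ ->] := E h u (fun _ _ => erefl).
have [e1 e2] := E h' t (hE t); have [e3 e4] := E h' u (hE u).
have := maxf_ge t0 (fun t => \sum_x sgn e x * h' t x) t.
have := maxf_ge t0 (fun t => \sum_x sgn e x * h' t x) u.
have := maxf_ge t0 (fun t => \sum_x sgn (flip x0 e) x * h' t x) t.
have := maxf_ge t0 (fun t => \sum_x sgn (flip x0 e) x * h' t x) u.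
rewrite -/(M h' e) -/(M h' (flip x0 e)) e1 e2 e3 e4.
move: (hL t u); rewrite /sgn.
case: (e x0); rewrite ?expr0 ?expr1;
  case: (ger0P (h t x0 - h u x0)); case: (ger0P (h' t x0 - h' u x0)); lra.
Qed.

Lemma contraction (h h' : I -> T -> R) :
  (forall t u x, `|h t x - h u x| <= `|h' t x - h' u x|) ->
  \sum_e maxf t0 (fun t => \sum_x sgn e x * h t x)
    <= \sum_e maxf t0 (fun t => \sum_x sgn e x * h' t x).
Proof.
move=> hL.
(* Hybrid family: the coordinates in [r] already use [h']. The induction on [r] switches one
   coordinate at a time. *)
pose k (r : seq T) t x := if x \in r then h' t x else h t x.
have ind r : \sum_e maxf t0 (fun t => \sum_x sgn e x * h t x)
    <= \sum_e maxf t0 (fun t => \sum_x sgn e x * k r t x).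
  elim: r => [|x0 r IH]; first by [].
  apply: (le_trans IH); apply: (@contraction_step _ _ x0) => [t x nx|t u].
    by rewrite /k inE (negbTE nx).
  by rewrite /k inE eqxx /=; case: ifP.
apply: (le_trans (ind (enum T))); apply: ler_sum => e _.
rewrite le_eqVlt; apply/orP; left; apply/eqP; apply: eq_maxf => t.
by apply: eq_bigr => x _; rewrite /k mem_enum.
Qed.

End Contraction.
End Rademacher.

Lemma sum_flipall (R : rcfType) (T : finType) (F : {ffun T -> bool} -> R) :
  \sum_(e : {ffun T -> bool}) F [ffun x => ~~ e x] = \sum_e F e.
Proof.
rewrite [RHS](reindex_inj (inv_inj (_ : involutive
  (fun e : {ffun T -> bool} => [ffun x => ~~ e x]))))//.
by move=> e; apply/ffunP => x; rewrite !ffunE negbK.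
Qed.

(** * Cut norms *)

Section CutNorm.
Variables (R : rcfType) (T : finType) (a : T -> T -> R).
Hypothesis a_le1 : forall x y, `|a x y| <= 1.
Implicit Types (A S Z U W : {set T}) (t : bool * {set T}).

Definition wt U W : R := \sum_(x in U) \sum_(y in W) a x y.

Definition posp (r : R) : R := Num.max r 0.

Lemma posp_ge0 r : 0 <= posp r.
Proof. by rewrite /posp le_max lexx orbT. Qed.

Lemma posp_ge r : r <= posp r.
Proof. by rewrite /posp le_max lexx. Qed.

Lemma posp_lip r r' : `|posp r - posp r'| <= `|r - r'|.
Proof.
rewrite /posp; case: (leP r 0); case: (leP r' 0) => h h';
  rewrite ?subrr ?normr0 ?normr_ge0// ?subr0 ?sub0r ?normrN.
  by rewrite gtr0_norm// ler0_norm; lra.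
by rewrite gtr0_norm// ger0_norm; lra.
Qed.

(* [t] is a pair (sign, W). *)
Definition rowf t A x : R := (-1) ^+ t.1 * \sum_(y in t.2 :&: A) a x y.

Definition possum t A S : R := \sum_(x in S) posp (rowf t A x).

(* Equal to the maximum of |a(U, W)| over U in S and W in A: given W and the sign, the
   best U collects the rows with a positive sum. *)
Definition cut S A : R := maxf (false, set0) (fun t => possum t A S).

Lemma possum_le t A S S' : S \subset S' -> possum t A S <= possum t A S'.
Proof.
move=> /subsetP sS; rewrite /possum [leRHS](bigID (mem S))/= -[leLHS]addr0.
apply: lerD; last by apply: sumr_ge0 => x _; apply: posp_ge0.
rewrite le_eqVlt; apply/orP; left; apply/eqP; apply: eq_bigl => x.
by case xS: (x \in S); rewrite ?andbF// andbT sS.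
Qed.

Lemma cut_ge0 S A : 0 <= cut S A.
Proof.
apply: (le_trans _ (maxf_ge _ _ (false, set0))).
by apply: sumr_ge0 => x _; apply: posp_ge0.
Qed.

Lemma wt_le_cut S A U W : U \subset S -> W \subset A -> `|wt U W| <= cut S A.
Proof.
move=> US WA.
suff [t ->] : exists t, `|wt U W| = \sum_(x in U) rowf t A x.
  apply: (@le_trans _ _ (possum t A U)).
    by apply: ler_sum => x _; apply: posp_ge.
  exact: le_trans (possum_le _ _ US) (maxf_ge _ _ t).
exists (wt U W < 0, W); rewrite /rowf /= -mulr_sumr (setIidPl WA) -/(wt U W).
by case: (ltP (wt U W) 0) => h; rewrite /= ?expr0 ?expr1 ?mulN1r ?mul1r;
  [rewrite ltr0_norm | rewrite ger0_norm].
Qed.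

Lemma cut_le S A c : (forall U W, U \subset S -> W \subset A -> `|wt U W| <= c) ->
  cut S A <= c.
Proof.
move=> h; apply: maxf_le => t.
pose U := [set x in S | 0 <= rowf t A x].
have -> : possum t A S = (-1) ^+ t.1 * wt U (t.2 :&: A).
  rewrite /wt mulr_sumr [possum _ _ _](bigID (mem U))/= [X in _ + X]big1 ?addr0.
    rewrite (eq_bigl (fun x => x \in U)) => [|x].
      by apply: eq_bigr => x; rewrite inE => /andP[_ hx]; rewrite /posp max_l.
    by rewrite !inE; case: (x \in S).
  move=> x; rewrite !inE => /andP[-> /=]; rewrite -ltNge => /ltW ?.
  by rewrite /posp max_r.
apply: (le_trans (ler_norm _)); rewrite normrMsign; apply: h.
  by apply/subsetP => x; rewrite inE => /andP[].
exact: subsetIr.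
Qed.

Lemma wt_le U W : `|wt U W| <= #|U|%:R * #|W|%:R.
Proof.
apply: (le_trans (ler_norm_sum _ _ _)).
rewrite mulr_natl -sumr_const; apply: ler_sum => x _.
apply: (le_trans (ler_norm_sum _ _ _)).
by rewrite -sumr_const; apply: ler_sum.
Qed.

(** After exchanging the sums, each [t] gives at most the sum over [y] in [A] of
    [|\sum_x sgn e x * a (g x) y|], which does not depend on [t]. Each term is a Rademacher sum with
    at most [l ^+ 2] coefficients of size at most 1. Rows outside [S] are set to 0 so that the signs
    range over all of [T]. *)
Lemma rademacher_rowf S A (g : T -> T) (l : R) : 0 < l -> #|S|%:R <= l ^+ 2 ->
  \sum_(e : {ffun T -> bool}) maxf (false, set0)
      (fun t => \sum_x sgn R e x * (if x \in S then rowf t A (g x) else 0))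
    <= #|{ffun T -> bool}|%:R * (#|A|%:R * l).
Proof.
move=> l0 hS.
pose v y x := if x \in S then a (g x) y else 0.
apply: (@le_trans _ _ (\sum_(e : {ffun T -> bool})
    \sum_(y in A) `|\sum_x sgn R e x * v y x|)).
  apply: ler_sum => e _; apply: maxf_le => -[d W].
  have -> : \sum_x sgn R e x * (if x \in S then rowf (d, W) A (g x) else 0)
     = \sum_(y in W :&: A) (-1) ^+ d * \sum_x sgn R e x * v y x.
    under [RHS]eq_bigr do rewrite mulr_sumr.
    rewrite exchange_big; apply: eq_bigr => x _.
    rewrite /v /rowf /=; case: ifP => _; last first.
      by rewrite mulr0 big1// => y _; rewrite !mulr0.
    by rewrite mulrCA !mulr_sumr.
  apply: (le_trans (ler_norm _)); apply: (le_trans (ler_norm_sum _ _ _)).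
  under eq_bigr do rewrite normrMsign.
  rewrite [leRHS](bigID (mem W))/= -[leLHS]addr0; apply: lerD.
    rewrite le_eqVlt; apply/orP; left; apply/eqP; apply: eq_bigl => y.
    by rewrite inE andbC.
  by apply: sumr_ge0 => y _.
rewrite exchange_big /= mulrCA mulr_natl -sumr_const; apply: ler_sum => y _.
apply: rademacher_L1 => //; apply: le_trans hS.
rewrite (bigID (mem S))/= [X in _ + X]big1 ?addr0 => [|x /negbTE xS]; last first.
  by rewrite /v xS expr0n.
rewrite -sumr_const; apply: ler_sum => x xS; rewrite /v xS.
by rewrite -real_normK ?num_real// expr_le1.
Qed.

(** The maximum of the difference is at most the sum of two maxima, the second with all signs
    negated, which is a bijection on sign vectors. As [posp] is 1-Lipschitz, [contraction] removes
    it from both, and [rademacher_rowf] applies twice. *)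
Lemma rademacher_posp_diff S A (g g' : T -> T) (l : R) :
  0 < l -> #|S|%:R <= l ^+ 2 ->
  \sum_(e : {ffun T -> bool}) maxf (false, set0) (fun t =>
      \sum_(x in S) sgn R e x * (posp (rowf t A (g x)) - posp (rowf t A (g' x))))
    <= #|{ffun T -> bool}|%:R * (2%:R * (#|A|%:R * l)).
Proof.
move=> l0 hS.
pose h (k : T -> T) t x := if x \in S then rowf t A (k x) else 0.
pose M e k := maxf (false, set0) (fun t => \sum_x sgn R e x * posp (h k t x)).
pose ne (e : {ffun T -> bool}) : {ffun T -> bool} := [ffun x => ~~ e x].
have hM k : \sum_e M e k <= #|{ffun T -> bool}|%:R * (#|A|%:R * l).
  apply: le_trans (rademacher_rowf A k l0 hS); apply: contraction => t u x.
  exact: posp_lip.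
apply: (@le_trans _ _ (\sum_e (M e g + M (ne e) g'))).
  apply: ler_sum => e _; apply: maxf_le => t.
  apply: (@le_trans _ _ (\sum_x sgn R e x * posp (h g t x)
       + \sum_x sgn R (ne e) x * posp (h g' t x))); last first.
    by apply: lerD;
      [apply: (maxf_ge _ (fun t => \sum_x sgn R e x * posp (h g t x)))
      |apply: (maxf_ge _ (fun t => \sum_x sgn R (ne e) x * posp (h g' t x)))].
  rewrite -big_split /= [leRHS](bigID (mem S))/= [X in _ + X]big1 ?addr0.
    apply: ler_sum => x xS; rewrite /h xS /sgn ffunE mulrBr.
    by case: (e x); rewrite /= ?expr0 ?expr1 ?mulN1r ?mul1r ?opprK.
  by move=> x /negbTE xS; rewrite /h xS /posp maxxx !mulr0 addr0.
rewrite big_split /= (sum_flipall (fun e => M e g')).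
by have := hM g; have := hM g'; lra.
Qed.

End CutNorm.

(** * Random permutations preserving a colouring *)

Section PermAverage.
Variables (R : rcfType) (T : finType) (J : eqType) (c : T -> J).
Implicit Types (s t : {perm T}) (f g : {perm T} -> R).

(** With the part of a vertex as its colour, these are the permutations that map each part onto
    itself. Their closure under left multiplication makes [avg] shift invariant. *)
Definition cperms : {set {perm T}} := [set s : {perm T} | [forall x, c (s x) == c x]].

Lemma cpermsP s : reflect (forall x, c (s x) = c x) (s \in cperms).
Proof. by rewrite inE; apply: (iffP forallP) => h x; apply/eqP. Qed.

Lemma cperms_mull t s : t \in cperms -> ((t * s)%g \in cperms) = (s \in cperms).
Proof.
move=> /cpermsP ht; apply/cpermsP/cpermsP => hs x.
  by rewrite -{1 2}(permKV t x) -permM hs ht.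
by rewrite permM hs ht.
Qed.

Definition avg f : R := (\sum_(s in cperms) f s) / #|cperms|%:R.

Lemma card_cperms_gt0 : 0 < #|cperms|%:R :> R.
Proof.
rewrite ltr0n card_gt0; apply/set0Pn; exists 1%g.
by apply/cpermsP => x; rewrite perm1.
Qed.

Lemma avg_le f g : (forall s, s \in cperms -> f s <= g s) -> avg f <= avg g.
Proof.
move=> h; rewrite /avg ler_pM2r ?invr_gt0 ?card_cperms_gt0//; exact: ler_sum.
Qed.

Lemma eq_avg f g : (forall s, s \in cperms -> f s = g s) -> avg f = avg g.
Proof. by move=> h; rewrite /avg; congr (_ / _); apply: eq_bigr. Qed.

Lemma avgD f g : avg (fun s => f s + g s) = avg f + avg g.
Proof. by rewrite /avg big_split mulrDl. Qed.

Lemma avgZ k f : avg (fun s => k * f s) = k * avg f.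
Proof. by rewrite /avg -mulr_sumr mulrA. Qed.

Lemma avg_cst k : avg (fun=> k) = k.
Proof.
by rewrite /avg sumr_const -[k *+ _]mulr_natr mulfK// gt_eqF ?card_cperms_gt0.
Qed.

Lemma avg_sum (I : finType) (D : pred I) (F : I -> {perm T} -> R) :
  avg (fun s => \sum_(i | D i) F i s) = \sum_(i | D i) avg (F i).
Proof. by rewrite /avg exchange_big /= mulr_suml. Qed.

Lemma avg_shift t f : t \in cperms -> avg (fun s => f (t * s)%g) = avg f.
Proof.
move=> ht; rewrite /avg; congr (_ / _).
rewrite [RHS](reindex_inj (mulgI t)) /=.
by apply: eq_bigl => s; rewrite cperms_mull.
Qed.

Lemma avg_ex f : exists2 s, s \in cperms & f s <= avg f.
Proof.
apply/exists_inP; apply: contraT; rewrite negb_exists_in => /forall_inP h.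
have := card_cperms_gt0; rewrite ltr0n card_gt0 => /set0Pn[s0 hs0].
have : \sum_(s in cperms) avg f < \sum_(s in cperms) f s.
  rewrite (bigD1 s0)//= [ltRHS](bigD1 s0)//=; apply: ltr_leD.
    by rewrite ltNge h.
  by apply: ler_sum => s /andP[hs _]; rewrite leNgt; apply/negP => /ltW; apply/negP/h.
rewrite sumr_const -[_ *+ _]mulr_natr /avg divfK ?ltxx//.
by rewrite gt_eqF ?card_cperms_gt0.
Qed.

End PermAverage.

(** Pair the elements of [A] and [B] that have the same rank in the two enumerations. The involution
    supplies the point by point exchange of two pieces. *)
Lemma matching_ex (T : finType) (A B : {set T}) :
  [disjoint A & B] -> #|A| = #|B| ->
  exists th : T -> T, [/\ involutive th,
    forall x, (th x \in A) = (x \in B), forall x, (th x \in B) = (x \in A) &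
    forall x, x \notin A -> x \notin B -> th x = x].
Proof.
move=> dAB cAB.
pose fw (C D : {set T}) x := nth x (enum D) (index x (enum C)).
have lt (C D : {set T}) x : #|C| = #|D| -> x \in C -> (index x (enum C) < size (enum D))%N.
  by move=> e xC; rewrite -cardE -e cardE index_mem mem_enum.
have fwin (C D : {set T}) x : #|C| = #|D| -> x \in C -> fw C D x \in D.
  by move=> e xC; rewrite -mem_enum mem_nth// lt.
have fwK (C D : {set T}) x : #|C| = #|D| -> x \in C -> fw D C (fw C D x) = x.
  move=> e xC; rewrite {1}/fw /fw index_uniq ?enum_uniq ?lt//.
  by rewrite (set_nth_default x) ?nth_index ?mem_enum// index_mem mem_enum.
pose th x := if x \in A then fw A B x else if x \in B then fw B A x else x.
have AB x : x \in A -> x \in B = false by apply: (disjointFr dAB).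
have BA x : x \in B -> x \in A = false by apply: (disjointFl dAB).
have thA x : x \in A -> th x \in B by move=> xA; rewrite /th xA fwin.
have thB x : x \in B -> th x \in A by move=> xB; rewrite /th (BA _ xB) xB fwin.
have thN x : x \notin A -> x \notin B -> th x = x.
  by move=> /negbTE xA /negbTE xB; rewrite /th xA xB.
exists th; split=> // x.
- have [xA|xA] := boolP (x \in A).
    by rewrite {1}/th (BA _ (thA _ xA)) thA// /th xA fwK.
  have [xB|xB] := boolP (x \in B).
    by rewrite {1}/th thB// /th xB (negbTE xA) fwK.
  by rewrite !thN.
- have [xA|xA] := boolP (x \in A); first by rewrite AB// BA ?thA.
  have [xB|xB] := boolP (x \in B); first by rewrite thB.
  by rewrite thN ?(negbTE xA).
- have [xA|xA] := boolP (x \in A); first by rewrite thA.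
  have [xB|xB] := boolP (x \in B); first by rewrite AB ?thB.
  by rewrite thN ?(negbTE xB).
Qed.

(** * Comparing two pieces by exchanging them at random *)

Section RowDeviation.
Variables (R : rcfType) (T : finType) (J : eqType) (c : T -> J).
Variable (a : T -> T -> R).
Hypothesis a_le1 : forall x y, `|a x y| <= 1.
Implicit Types (A B Z : {set T}).

Lemma imset_permM (s t : {perm T}) Z : (t * s)%g @: Z = s @: (t @: Z).
Proof. by rewrite -imset_comp; apply: eq_imset => x; rewrite permM. Qed.

(** For each sign vector [e], let [tau e] swap [x] in [A] with [th x] exactly when [e x] holds. It
    preserves the colours, and [hZ] makes it preserve [Z], so shifting by [tau e] leaves the average
    unchanged. Averaging over [e] as well turns the difference between [A] and [B] into a signed
    sum, which [rademacher_posp_diff] bounds for each fixed [s]. *)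
Lemma row_deviation A B Z j (l : R) :
  [disjoint A & B] -> #|A| = #|B| ->
  (forall x, x \in A :|: B -> c x = j) ->
  [disjoint A :|: B & Z] \/ A :|: B \subset Z ->
  0 < l -> #|A|%:R <= l ^+ 2 ->
  avg c (fun s => maxf (false, set0) (fun t =>
      possum a t (s @: Z) (s @: A) - possum a t (s @: Z) (s @: B)))
    <= 2%:R * (#|Z|%:R * l).
Proof.
move=> dAB cAB cj hZ l0 hl.
have [th [thK thA thB thN]] := matching_ex dAB cAB.
have thAB x : (th x \in A :|: B) = (x \in A :|: B) by rewrite !inE thA thB orbC.
have cth x : c (th x) = c x.
  have [xAB|] := boolP (x \in A :|: B); first by rewrite !cj ?thAB.
  by rewrite inE negb_or => /andP[xA xB]; rewrite thN.
have thZ x : (th x \in Z) = (x \in Z).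
  have [xAB|] := boolP (x \in A :|: B); last first.
    by rewrite inE negb_or => /andP[xA xB]; rewrite thN.
  case: hZ => [d|/subsetP h]; last by rewrite !h ?thAB.
  by rewrite !(disjointFr d) ?thAB.
(* A matched pair is governed by the value of [e] at its endpoint in [A], so both endpoints agree on
   whether they are swapped. *)
pose fl (e : {ffun T -> bool}) x := (x \in A) && e x || (th x \in A) && e (th x).
pose sw e x := if fl e x then th x else x.
have swK e : involutive (sw e).
  have flth x : fl e (th x) = fl e x by rewrite /fl thK orbC.
  by move=> x; rewrite /sw; case E: (fl e x); rewrite ?flth E ?thK.
pose tau e := perm (inv_inj (swK e)).
have tauG e : tau e \in cperms c.
  by apply/cpermsP => x; rewrite permE /sw; case: ifP; rewrite ?cth.
have tauZ e : tau e @: Z = Z.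
  apply/eqP; rewrite eqEcard card_imset ?leqnn ?andbT; last exact: perm_inj.
  apply/subsetP => _ /imsetP[x xZ ->].
  by rewrite permE /sw; case: ifP; rewrite ?thZ.
have flA e x : x \in A -> fl e x = e x.
  by move=> xA; rewrite /fl thA xA (disjointFr dAB xA) /= orbF.
have flB e x : x \in A -> fl e (th x) = e x.
  by move=> xA; rewrite /fl thA thK xA (disjointFr dAB xA).
pose D s := maxf (false, set0) (fun t =>
      possum a t (s @: Z) (s @: A) - possum a t (s @: Z) (s @: B)).
have thBE : B = th @: A.
  apply/eqP; rewrite eq_sym eqEcard card_imset -?cAB ?leqnn ?andbT; last exact: inv_inj.
  by apply/subsetP => _ /imsetP[x xA ->]; rewrite thB.
have Dtau e s : D (tau e * s)%g = maxf (false, set0) (fun t => \sum_(x in A)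
    sgn R e x * (posp (rowf a t (s @: Z) (s x)) - posp (rowf a t (s @: Z) (s (th x))))).
  apply: eq_maxf => t; rewrite imset_permM tauZ /possum.
  rewrite !big_imset /=; try by move=> ? ? _ _; apply: perm_inj.
  rewrite [X in _ - X](_ : _ = \sum_(x in A) posp (rowf a t (s @: Z) ((tau e * s)%g (th x)))).
    rewrite -sumrB; apply: eq_bigr => x xA.
    rewrite !permM !permE /sw flA// flB// /sgn thK.
    by case: (e x); rewrite ?expr0 ?expr1 ?mul1r// mulN1r opprB.
  by rewrite {1}thBE big_imset //= => ? ? _ _; apply: inv_inj.
have N0 : 0 < #|{ffun T -> bool}|%:R :> R.
  by rewrite ltr0n; apply/card_gt0P; exists [ffun=> false].
rewrite -(ler_pM2l N0) -/D.
have -> : #|{ffun T -> bool}|%:R * avg c D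
    = avg c (fun s => \sum_(e : {ffun T -> bool}) D (tau e * s)%g).
  rewrite avg_sum /= (eq_bigr (fun=> avg c D)) => [|e _]; last exact: avg_shift.
  by rewrite sumr_const mulr_natl.
rewrite -[leRHS](avg_cst c); apply: avg_le => s _.
under eq_bigr do rewrite Dtau.
have -> : #|Z| = #|s @: Z| by rewrite card_imset//; apply: perm_inj.
exact: rademacher_posp_diff.
Qed.

End RowDeviation.

(** The row form of [cut] looks asymmetric, but [wt_le_cut] and [cut_le] identify it with a maximum
    over rectangles. Column sampling can therefore reuse the row lemmas. *)
Lemma cut_tr (R : rcfType) (T : finType) (a : T -> T -> R) (S A : {set T}) :
  cut (fun x y => a y x) S A = cut a A S.
Proof.
have wtT (b : T -> T -> R) U W : wt (fun x y => b y x) U W = wt b W U.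
  exact: exchange_big.
apply/eqP; rewrite eq_le; apply/andP; split; apply: cut_le => U W US WA.
  by rewrite wtT wt_le_cut.
by rewrite -wtT wt_le_cut.
Qed.

(** * Sampling rows *)

Section Sampling.
Variables (R : rcfType) (T : finType) (J : eqType) (c : T -> J).
Implicit Types (A B S X Y Z : {set T}) (F L : {set {set T}}) (s : {perm T}).

Definition color_class X j := forall x, (x \in X) = (c x == j).

Lemma imset_color_class X j s : color_class X j -> s \in cperms c -> s @: X = X.
Proof.
move=> hX /cpermsP hs; apply/eqP.
rewrite eqEcard card_imset ?leqnn ?andbT; last exact: perm_inj.
by apply/subsetP => _ /imsetP[x xX ->]; rewrite hX hs -hX.
Qed.

Lemma color_class_sub_or_disjoint X Y i j A :
  color_class X i -> color_class Y j -> A \subset Y ->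
  [disjoint A & X] \/ A \subset X.
Proof.
move=> hX hY AY; have [eij|nij] := eqVneq i j.
  right; apply: (subset_trans AY); apply/subsetP => x.
  by rewrite hX hY eij.
left; rewrite disjoint_subset; apply/subsetP => x /(subsetP AY).
by rewrite inE hX hY => /eqP ->; rewrite eq_sym.
Qed.

Section CutRows.
Variable (a : T -> T -> R).
Hypothesis a_le1 : forall x y, `|a x y| <= 1.

(** Let [t] attain the cut norm for [S]. Over the disjoint sets of [L], the values of [possum] at
    this [t] add up to at most the cut norm on all of [X]. Replacing [S] by another [A] in [L] costs
    [D A], whose average is bounded by [row_deviation]. *)
Lemma cut_sample_rows X j L S Z k (l : R) :
  color_class X j -> trivIset L ->
  (forall A, A \in L -> A \subset X /\ #|A| = k) ->
  (forall A, A \in L -> [disjoint A & Z]) \/ X \subset Z ->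
  0 < l -> k%:R <= l ^+ 2 -> S \in L ->
  #|L|%:R * avg c (fun s => cut a (s @: S) (s @: Z))
    <= avg c (fun s => cut a X (s @: Z)) + #|L|%:R * (2%:R * (#|Z|%:R * l)).
Proof.
move=> hX tL hL hZ l0 hl SL; have [SX cS] := hL _ SL.
pose D A s := maxf (false, set0) (fun t =>
      possum a t (s @: Z) (s @: S) - possum a t (s @: Z) (s @: A)).
have avgDle A : A \in L -> avg c (D A) <= 2%:R * (#|Z|%:R * l).
  move=> AL; have [AX cA] := hL _ AL.
  have [->|nAS] := eqVneq A S.
    rewrite -[leRHS](avg_cst c); apply: avg_le => s _; apply: maxf_le => t.
    by rewrite subrr !mulr_ge0 ?ler0n ?ltW.
  apply: (@row_deviation _ _ _ c a a_le1 S A Z j) => //; rewrite ?cS ?cA//.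
  - by move/trivIsetP: tL; apply; rewrite // eq_sym.
  - by move=> x; rewrite inE => /orP[/(subsetP SX)|/(subsetP AX)]; rewrite hX => /eqP.
  - case: hZ => hZ; last by right; rewrite subUset !(subset_trans _ hZ).
    by left; rewrite disjoints_subset subUset -!disjoints_subset !hZ.
apply: (@le_trans _ _ (avg c (fun s => cut a X (s @: Z) + \sum_(A in L) D A s))).
  rewrite -avgZ; apply: avg_le => s hs.
  have [t ht] := maxf_ex (false, set0) (fun t => possum a t (s @: Z) (s @: S)).
  have h1 : \sum_(A in L) (possum a t (s @: Z) (s @: S) - possum a t (s @: Z) (s @: A))
      <= \sum_(A in L) D A s.
    apply: ler_sum => A _.
    exact: (maxf_ge _ (fun t => possum a t (s @: Z) (s @: S) - possum a t (s @: Z) (s @: A))).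
  have h2 : \sum_(A in L) possum a t (s @: Z) (s @: A) <= cut a X (s @: Z).
    apply: le_trans (maxf_ge _ (fun t => possum a t (s @: Z) X) t).
    have -> : \sum_(A in L) possum a t (s @: Z) (s @: A)
        = possum a t (s @: Z) (s @: cover L).
      rewrite /possum big_imset /=; last by move=> ? ? _ _; apply: perm_inj.
      rewrite big_trivIset//; apply: eq_bigr => A _.
      by rewrite big_imset //= => ? ? _ _; apply: perm_inj.
    apply: possum_le; rewrite -(imset_color_class hX hs); apply: imsetS.
    by apply/bigcupsP => A /hL[].
  rewrite sumrB sumr_const -[_ *+ _]mulr_natl -ht -/(cut _ _ _) in h1.
  by move: h1 h2; lra.
rewrite avgD lerD2l avg_sum mulr_natl -sumr_const.
exact: ler_sum.
Qed.

End CutRows.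

(** * Second moment of a sum sampled without replacement *)

Section Exchangeable.
Variables (X0 S : {set T}) (j : J) (h : {perm T} -> T -> R) (b : R).
Hypotheses (X0j : forall x, x \in X0 -> c x = j) (SX0 : S \subset X0).
Hypothesis h_inv : forall s x y, x \in X0 -> y \in X0 -> h (tperm x y * s)%g = h s.
Hypotheses (b_gt0 : 0 < b) (h_le : forall s x, `|h s x| <= b).

Let mu s := (\sum_(x in X0) h s (s x)) / #|X0|%:R.
Let H s x := h s (s x) - mu s.

Let tpG x y : x \in X0 -> y \in X0 -> tperm x y \in cperms c.
Proof.
move=> xX yX; apply/cpermsP => z; case: tpermP => [->|->|//]; by rewrite !X0j.
Qed.

(** The weight [h s] may depend on [s], but not through transpositions inside [X0]. Shifting by such
    a transposition thus only permutes the centred values, which makes them exchangeable under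
    [avg]. *)
Let HM s x y z : x \in X0 -> y \in X0 -> H (tperm x y * s)%g z = H s (tperm x y z).
Proof.
move=> xX yX; rewrite /H permM h_inv//; congr (_ - _); rewrite /mu h_inv//.
congr (_ / _); rewrite [RHS](reindex_inj (@perm_inj _ (tperm x y))) /=.
apply: eq_big => [u|u _]; last by rewrite permM.
by case: tpermP => [->|->|//]; rewrite xX yX.
Qed.

Let X0_gt0 x : x \in X0 -> 0 < #|X0|%:R :> R.
Proof. by move=> xX; rewrite ltr0n; apply/card_gt0P; exists x. Qed.

Let sumH s x : x \in X0 -> \sum_(y in X0) H s y = 0.
Proof.
move=> xX; rewrite sumrB sumr_const -[_ *+ _]mulr_natr /mu divfK ?subrr//.
by rewrite gt_eqF ?(X0_gt0 xX).
Qed.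

Let H_le s x : x \in X0 -> H s x ^+ 2 <= (2%:R * b) ^+ 2.
Proof.
move=> xX.
have hmu : `|mu s| <= b.
  rewrite /mu normrM normfV (ger0_norm (ler0n _ _)) ler_pdivrMr ?(X0_gt0 xX)//.
  apply: (le_trans (ler_norm_sum _ _ _)); rewrite mulr_natr -sumr_const.
  by apply: ler_sum.
have : `|H s x| <= 2%:R * b.
  by apply: (le_trans (ler_normB _ _)); have := h_le s (s x); move: hmu; lra.
rewrite -[H s x ^+ 2]real_normK ?num_real// => hH.
by rewrite lerXn2r// nnegrE// ?mulr_ge0// ltW.
Qed.

(* All covariances of distinct points are equal, and the values of [H] sum to zero. *)
Let cov_le0 x y : x \in X0 -> y \in X0 -> y != x ->
  avg c (fun s => H s x * H s y) <= 0.
Proof.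
move=> xX yX nyx.
have e z : z \in X0 -> z != x ->
    avg c (fun s => H s x * H s z) = avg c (fun s => H s x * H s y).
  move=> zX nzx; rewrite -(avg_shift _ (tpG yX zX)); apply: eq_avg => s _.
  by rewrite !HM// tpermR tpermD.
have : \sum_(z in X0) avg c (fun s => H s x * H s z) = 0.
  rewrite -avg_sum /= -[RHS](avg_cst c); apply: eq_avg => s _.
  by rewrite -mulr_sumr (sumH s xX) mulr0.
rewrite (bigD1 x)//= (eq_bigr (fun=> avg c (fun s => H s x * H s y))); last first.
  by move=> z /andP[zX nzx]; apply: e.
rewrite sumr_const -[_ *+ _]mulr_natl => e0.
set N := #|_| in e0.
have N0 : 0 < N%:R :> R.
  by rewrite ltr0n; apply/card_gt0P; exists y; apply/andP.
rewrite -(pmulr_rle0 _ N0) -[leRHS]e0 lerDr -(avg_cst c 0); apply: avg_le => s _.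
by rewrite -expr2 sqr_ge0.
Qed.

(** The off-diagonal covariances are nonpositive, so the second moment is at most its diagonal part,
    hence at most [#|S|] times [(2 b)^2]. Then [abs_le_sqr] with parameter [2 b l] gives the first
    moment. *)
Lemma mean_deviation (l : R) : 0 < l -> #|S|%:R <= l ^+ 2 ->
  avg c (fun s => `|\sum_(x in S) h s (s x)
      - #|S|%:R / #|X0|%:R * \sum_(x in X0) h s (s x)|) <= 2%:R * (b * l).
Proof.
move=> l0 hl; pose Y s := \sum_(x in S) H s x.
have -> : avg c (fun s => `|\sum_(x in S) h s (s x)
    - #|S|%:R / #|X0|%:R * \sum_(x in X0) h s (s x)|) = avg c (fun s => `|Y s|).
  apply: eq_avg => s _; congr `|_|; rewrite /Y sumrB; congr (_ - _).
  by rewrite sumr_const -[mu s *+ _]mulr_natl /mu [LHS]mulrAC ?mulrA.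
have Y2 : avg c (fun s => Y s ^+ 2) <= (2%:R * b * l) ^+ 2.
  have -> : avg c (fun s => Y s ^+ 2)
      = \sum_(x in S) \sum_(y in S) avg c (fun s => H s x * H s y).
    under [RHS]eq_bigr do rewrite -avg_sum.
    rewrite -avg_sum; apply: eq_avg => s _.
    by rewrite expr2 /Y mulr_suml; apply: eq_bigr => x _; rewrite mulr_sumr.
  rewrite exprMn; apply: (@le_trans _ _ (\sum_(x in S) (2%:R * b) ^+ 2)); last first.
    rewrite sumr_const -[_ *+ _]mulr_natr ler_wpM2l// sqr_ge0//.
  apply: ler_sum => x xS; have xX := subsetP SX0 _ xS.
  rewrite (bigD1 x)//= -[leRHS]addr0; apply: lerD.
    rewrite -[leRHS](avg_cst c); apply: avg_le => s _.
    by rewrite -expr2 H_le.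
  apply: sumr_le0 => y /andP[/(subsetP SX0) yX nyx].
  exact: cov_le0.
set d := 2%:R * b * l in Y2; have d0 : 0 < d by rewrite !mulr_gt0 ?ltr0n.
have -> : 2%:R * (b * l) = d by rewrite /d mulrA.
clearbody d.
apply: (@le_trans _ _ (avg c (fun s => (2%:R * d)^-1 * Y s ^+ 2 + d / 2%:R))).
  apply: avg_le => s _; apply: (le_trans (abs_le_sqr _ d0)).
  by rewrite le_eqVlt; apply/orP; left; apply/eqP; field; lra.
rewrite avgD avg_cst (avgZ _ (2%:R * d)^-1).
have : (2%:R * d)^-1 * avg c (fun s => Y s ^+ 2) <= (2%:R * d)^-1 * d ^+ 2.
  by rewrite ler_wpM2l// invr_ge0 mulr_ge0// ltW.
have -> : (2%:R * d)^-1 * d ^+ 2 = d / 2%:R by field; lra.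
by lra.
Qed.

End Exchangeable.
End Sampling.

(** * Sampling rows and columns *)

Section PairSampling.
Variables (R : rcfType) (T : finType) (J : eqType) (c : T -> J).
Implicit Types (A B C D S X Y Z : {set T}) (F L : {set {set T}}) (s : {perm T}).

Lemma card_packing L A k : trivIset L ->
  (forall B, B \in L -> B \subset A /\ #|B| = k) -> (#|L| * k <= #|A|)%N.
Proof.
move=> /eqP tL hL; rewrite -sum_nat_const (eq_bigr (fun B => #|B|)).
  by rewrite tL subset_leq_card//; apply/bigcupsP => B /hL[].
by move=> B /hL[].
Qed.

(** Apply [mean_deviation] to the row sums over [s @: Z]. A transposition inside [X0] maps [Z] onto
    itself, because [X0] is disjoint from [Z] or contained in it. *)
Lemma mean_sample (a : T -> T -> R) X0 S Z j (l : R) :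
  (forall x y, `|a x y| <= 1) ->
  (forall x, x \in X0 -> c x = j) -> S \subset X0 ->
  [disjoint X0 & Z] \/ X0 \subset Z -> (0 < #|Z|)%N ->
  0 < l -> #|S|%:R <= l ^+ 2 ->
  avg c (fun s => `|wt a (s @: S) (s @: Z)|)
    <= #|S|%:R / #|X0|%:R * avg c (fun s => `|wt a (s @: X0) (s @: Z)|)
       + 2%:R * (#|Z|%:R * l).
Proof.
move=> a1 cX0 SX0 hZ Z0 l0 hl.
pose h s x := \sum_(y in s @: Z) a x y.
have wtE s A : wt a (s @: A) (s @: Z) = \sum_(x in A) h s (s x).
  by rewrite /wt big_imset //= => ? ? _ _; apply: perm_inj.
have h_inv s x y : x \in X0 -> y \in X0 -> h (tperm x y * s)%g = h s.
  move=> xX yX; rewrite /h imset_permM (_ : tperm x y @: Z = Z)//.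
  apply/eqP; rewrite eqEcard card_imset ?leqnn ?andbT; last exact: perm_inj.
  apply/subsetP => _ /imsetP[z zZ ->]; case: tpermP => // e.
    by case: hZ => [d|/subsetP -> //]; rewrite e (disjointFr d xX) in zZ.
  by case: hZ => [d|/subsetP -> //]; rewrite e (disjointFr d yX) in zZ.
have h_le s x : `|h s x| <= #|Z|%:R.
  apply: (le_trans (ler_norm_sum _ _ _)).
  rewrite -(card_imset Z (@perm_inj _ s)) -sumr_const.
  exact: ler_sum.
have Z0' : 0 < #|Z|%:R :> R by rewrite ltr0n.
have := mean_deviation cX0 SX0 h_inv Z0' h_le l0 hl.
rewrite -(lerD2l (#|S|%:R / #|X0|%:R * avg c (fun s => `|wt a (s @: X0) (s @: Z)|))).
move=> H; apply: le_trans H.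
rewrite -avgZ -avgD; apply: avg_le => s _; rewrite !wtE.
set u := \sum_(x in S) _; set v := \sum_(x in X0) _; set r := _ / _.
have r0 : 0 <= r by rewrite divr_ge0.
by rewrite -{1}(ger0_norm r0) -normrM -{1}(subrK (r * v) u) addrC ler_normD.
Qed.

Section Pairs.
Variables (a : T -> T -> R) (F : {set {set T}}) (X Y : {set T}) (i j : J).
Variables (k : nat) (l : R).
Hypothesis a_le1 : forall x y, `|a x y| <= 1.
Hypotheses (F_triv : trivIset F) (F_card : forall A, A \in F -> #|A| = k).
Hypotheses (Xi : color_class c X i) (Yj : color_class c Y j).
Hypotheses (l_gt0 : 0 < l) (l_sqr : l ^+ 2 = k%:R).

Let fam A := [set B in F | B \subset A].

Let famP A B : B \in fam A -> [/\ B \in F, B \subset A & #|B| = k].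
Proof. by rewrite inE => /andP[BF BA]; split; rewrite // F_card. Qed.

Let fam_triv A : trivIset (fam A).
Proof. by apply: trivIsetS F_triv; apply/subsetP => B /famP[]. Qed.

Let famD_triv A D : trivIset (fam A :\ D).
Proof. exact: trivIsetS (subsetDl _ _) (fam_triv A). Qed.

Let famD_disj A D B : D \in F -> B \in fam A :\ D -> [disjoint B & D].
Proof.
by move=> DF /setD1P[nBD /famP[BF _ _]]; move/trivIsetP: F_triv; apply.
Qed.

Let k_gt0 : 0 < k%:R :> R.
Proof. by rewrite -l_sqr exprn_gt0. Qed.

Let fam_le A : #|fam A|%:R * k%:R <= #|A|%:R :> R.
Proof.
rewrite -natrM ler_nat; apply: card_packing (fam_triv A) _ => B.
by case/famP.
Qed.

Let famD_le A D : D \in F -> #|fam A :\ D|%:R * k%:R <= #|A :\: D|%:R :> R.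
Proof.
move=> DF; rewrite -natrM ler_nat; apply: card_packing (famD_triv A D) _ => B BD.
have dBD := famD_disj DF BD; move/setD1P: BD => [_ /famP[_ BA ->]]; split=> //.
by rewrite subsetD BA.
Qed.

Let a_tr_le1 x y : `|a y x| <= 1. Proof. exact: a_le1. Qed.

Let class_color A n : color_class c A n -> forall x, x \in A -> c x = n.
Proof. by move=> hA x; rewrite hA => /eqP. Qed.

Let square_error (p q : R) : 0 <= q -> p * k%:R <= #|X|%:R -> q * k%:R <= #|Y|%:R ->
  p * q * (k%:R * l) <= #|X|%:R * #|Y|%:R / l.
Proof.
move=> q0 hp hq; rewrite ler_pdivlMr//.
have -> : p * q * (k%:R * l) * l = (p * k%:R) * (q * k%:R).
  by rewrite -l_sqr; ring.
apply: (@le_trans _ _ (#|X|%:R * (q * k%:R))).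
  by rewrite ler_wpM2r// mulr_ge0// ltW.
by rewrite ler_wpM2l.
Qed.

Let line_error (q : R) : q * k%:R <= #|Y|%:R ->
  q * (#|X|%:R * l) <= #|X|%:R * #|Y|%:R / l.
Proof.
move=> hq; rewrite ler_pdivlMr//.
have -> : q * (#|X|%:R * l) * l = #|X|%:R * (q * k%:R) by rewrite -l_sqr; ring.
by rewrite ler_wpM2l.
Qed.

(** Sample rows for fixed [D], with [D] itself left out so that the row pieces are disjoint from it.
    Then sample columns, after transposing. Each of the two samplings contributes an error of at
    most twice [|X||Y| / l]. *)
Lemma cut_pairs :
  \sum_(D in fam Y) \sum_(C in fam X :\ D) avg c (fun s => cut a (s @: C) (s @: D))
    <= cut a X Y + 4%:R * (#|X|%:R * #|Y|%:R / l).
Proof.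
have k_le : k%:R <= l ^+ 2 by rewrite l_sqr.
have row D : D \in fam Y ->
    \sum_(C in fam X :\ D) avg c (fun s => cut a (s @: C) (s @: D))
    <= avg c (fun s => cut a X (s @: D)) + #|fam X :\ D|%:R * (2%:R * (k%:R * l)).
  move=> /famP[DF DY cD].
  have e0 : 0 <= avg c (fun s => cut a X (s @: D)).
    by rewrite -(avg_cst c 0); apply: avg_le => s _; apply: cut_ge0.
  set q := #|_|%:R.
  (* The factor [q] in [cut_sample_rows] is cancelled by summing over the [q] pieces, so an empty
     family is treated apart. *)
  have [q0|nq0] := eqVneq q 0.
    rewrite q0 mul0r addr0 big1// => C hC; have : 0 < q.
      by rewrite ltr0n; apply/card_gt0P; exists C.
    by rewrite q0 ltxx.
  have q0 : 0 < q by rewrite lt_def nq0 ler0n.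
  rewrite -(ler_pM2l q0) mulr_sumr.
  apply: (@le_trans _ _ (\sum_(C in fam X :\ D)
    (avg c (fun s => cut a X (s @: D)) + q * (2%:R * (k%:R * l))))).
    apply: ler_sum => C hC; rewrite -cD.
    apply: (cut_sample_rows a_le1 Xi (famD_triv X D) _ _ l_gt0 k_le hC).
      by move=> B /setD1P[_ /famP[]].
    by left => B; apply: famD_disj.
  by rewrite sumr_const -[_ *+ _]mulr_natl -/q.
have col D : D \in fam Y -> #|fam Y|%:R * avg c (fun s => cut a X (s @: D))
    <= cut a X Y + #|fam Y|%:R * (2%:R * (#|X|%:R * l)).
  move=> hD.
  have -> : avg c (fun s => cut a X (s @: D))
      = avg c (fun s => cut (fun x y => a y x) (s @: D) (s @: X)).
    by apply: eq_avg => s hs; rewrite cut_tr (imset_color_class Xi hs).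
  have -> : cut a X Y = avg c (fun s => cut (fun x y => a y x) Y (s @: X)).
    rewrite -[LHS](avg_cst c); apply: eq_avg => s hs.
    by rewrite cut_tr (imset_color_class Xi hs).
  apply: (cut_sample_rows a_tr_le1 Yj (fam_triv Y) _ _ l_gt0 k_le hD).
    by move=> B /famP[].
  case: (color_class_sub_or_disjoint Xi Yj (subxx Y)) => h; last by right.
  by left => B /famP[_ BY _]; apply: disjointWl h.
apply: (le_trans (ler_sum _ row)).
have [/eqP q0|] := posnP #|fam Y|.
  rewrite big1 => [|D hD]; last by rewrite cards_eq0 in q0; rewrite (eqP q0) inE in hD.
  by rewrite addr_ge0 ?cut_ge0// !mulr_ge0 ?invr_ge0// ltW.
rewrite -(ltr0n R) => q0.
rewrite big_split /=.
have h1 : \sum_(D in fam Y) avg c (fun s => cut a X (s @: D))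
    <= cut a X Y + 2%:R * (#|X|%:R * #|Y|%:R / l).
  rewrite -(ler_pM2l q0) mulr_sumr; apply: (le_trans (ler_sum _ col)).
  rewrite sumr_const -[_ *+ _]mulr_natl ler_pM2l// lerD2l mulrCA ler_wpM2l//.
  exact: line_error.
have h2 : \sum_(D in fam Y) #|fam X :\ D|%:R * (2%:R * (k%:R * l))
    <= 2%:R * (#|X|%:R * #|Y|%:R / l).
  apply: (@le_trans _ _ (\sum_(D in fam Y) #|fam X|%:R * (2%:R * (k%:R * l)))).
    apply: ler_sum => D _; rewrite ler_wpM2r ?ler_nat ?subset_leq_card ?subsetDl//.
    by rewrite !mulr_ge0// ltW.
  rewrite sumr_const -[_ *+ _]mulr_natl.
  have := square_error (ler0n R #|fam Y|) (fam_le X) (fam_le Y).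
  by lra.
by move: h1 h2; lra.
Qed.

(** Sampling the columns starts from the total weight 0 on [X] and [Y]; the rows are then sampled
    from [X :\: D]. If [X = Y], removing [D] from the rows changes the weight by at most [k ^+ 2],
    which produces the last term. *)
Lemma wt_pairs : wt a X Y = 0 ->
  \sum_(D in fam Y) \sum_(C in fam X :\ D) avg c (fun s => `|wt a (s @: C) (s @: D)|)
    <= 6%:R * (#|X|%:R * #|Y|%:R / l) + (X == Y)%:R * (k%:R * #|X|%:R).
Proof.
move=> wt0.
have col D : D \in fam Y -> (0 < #|X|)%N ->
    avg c (fun s => `|wt a X (s @: D)|) <= 2%:R * (#|X|%:R * l).
  move=> /famP[DF DY cD] X0.
  have -> : avg c (fun s => `|wt a X (s @: D)|)
      = avg c (fun s => `|wt (fun x y => a y x) (s @: D) (s @: X)|).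
    apply: eq_avg => s hs; rewrite (imset_color_class Xi hs).
    by rewrite /wt exchange_big.
  have hYX : [disjoint Y & X] \/ Y \subset X.
    exact: color_class_sub_or_disjoint Xi Yj (subxx Y).
  have hl : #|D|%:R <= l ^+ 2 by rewrite cD l_sqr.
  apply: (le_trans (mean_sample a_tr_le1 (class_color Yj) DY hYX X0 l_gt0 hl)).
  rewrite [avg c _](_ : _ = 0) ?mulr0 ?add0r// -[RHS](avg_cst c); apply: eq_avg => s hs.
  rewrite (imset_color_class Xi hs) (imset_color_class Yj hs).
  by rewrite /wt exchange_big -/(wt a X Y) wt0 normr0.
have row D C : D \in fam Y -> C \in fam X :\ D ->
    avg c (fun s => `|wt a (s @: C) (s @: D)|)
    <= 6%:R * (k%:R * l) + (X == Y)%:R * (k%:R / #|X :\: D|%:R * k%:R ^+ 2).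
  move=> hD hC; have dCD := famD_disj (let: And3 h _ _ := famP hD in h) hC.
  have [DF DY cD] := famP hD; have [nCD /famP[CF CX cC]] := setD1P hC.
  have CX0 : C \subset X :\: D by rewrite subsetD CX.
  have k0 : (0 < k)%N by rewrite -(ltr0n R).
  have X0 : (0 < #|X|)%N by rewrite (leq_trans k0)// -cC subset_leq_card.
  have kX0 : (k <= #|X :\: D|)%N by rewrite -cC subset_leq_card.
  have D0 : (0 < #|D|)%N by rewrite cD.
  have hl : #|C|%:R <= l ^+ 2 by rewrite cC l_sqr.
  have dX0 : [disjoint X :\: D & D] \/ X :\: D \subset D.
    by left; rewrite disjoints_subset setDE subsetIr.
  have cX0 x : x \in X :\: D -> c x = i by case/setDP => /(class_color Xi).
  apply: (le_trans (mean_sample a_le1 cX0 CX0 dX0 D0 l_gt0 hl)).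
  rewrite cC cD.
  have X0pos : 0 < #|X :\: D|%:R :> R by rewrite ltr0n (leq_trans k0).
  have r0 : 0 <= k%:R / #|X :\: D|%:R :> R by rewrite divr_ge0.
  (* The piece [C] fits in [X :\: D], so removing [D] at most halves [X]. This is where the 4 in
     [h3] comes from. *)
  have XleR : #|X|%:R <= 2%:R * #|X :\: D|%:R :> R.
    rewrite -natrM ler_nat mul2n -addnn -(cardsID D X) leq_add2r.
    by apply: leq_trans kX0; rewrite -cD subset_leq_card// subsetIr.
  have wtD s : s \in cperms c -> `|wt a (s @: (X :\: D)) (s @: D)|
      <= `|wt a X (s @: D)| + (X == Y)%:R * k%:R ^+ 2.
    move=> hs.
    have -> : wt a (s @: (X :\: D)) (s @: D)
        = wt a X (s @: D) - wt a (s @: (X :&: D)) (s @: D).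
      rewrite -{2}(imset_color_class Xi hs) /wt.
      rewrite !big_imset /=; try by move=> ? ? _ _; apply: perm_inj.
      by apply/eqP; rewrite eq_sym subr_eq addrC [eqbLHS](big_setID D).
    apply: (le_trans (ler_normB _ _)); rewrite lerD2l.
    have [eXY|nXY] := eqVneq X Y; rewrite ?mul1r ?mul0r.
      apply: (le_trans (wt_le a_le1 _ _)).
      rewrite !card_imset; try exact: perm_inj.
      by rewrite expr2 cD ler_wpM2r// ler_nat -cD subset_leq_card// subsetIr.
    rewrite (_ : X :&: D = set0) ?imset0 /wt ?big_set0 ?normr0//.
    case: (color_class_sub_or_disjoint Xi Yj DY) => [d|DX].
      by rewrite setIC; apply: disjoint_setI0.
    case/eqP: nXY; move/card_gt0P: D0 => [x xD].
    apply/setP => y; rewrite Xi Yj.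
    by rewrite -(class_color Xi (subsetP DX _ xD)) -(class_color Yj (subsetP DY _ xD)).
  have h1 : avg c (fun s => `|wt a (s @: (X :\: D)) (s @: D)|)
      <= 2%:R * (#|X|%:R * l) + (X == Y)%:R * k%:R ^+ 2.
    apply: (le_trans (avg_le wtD)); rewrite avgD avg_cst lerD2r.
    exact: col.
  have h2 := ler_wpM2l r0 h1; rewrite mulrDr in h2.
  have h3 : k%:R / #|X :\: D|%:R * (2%:R * (#|X|%:R * l)) <= 4%:R * (k%:R * l).
    rewrite mulrAC ler_pdivrMr//.
    have := ler_wpM2l (mulr_ge0 (ltW k_gt0) (ltW l_gt0)) XleR.
    by lra.
  by rewrite [in leRHS]mulrCA; move: h2 h3; lra.
have rowsum D : D \in fam Y ->
    \sum_(C in fam X :\ D) avg c (fun s => `|wt a (s @: C) (s @: D)|)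
    <= #|fam X|%:R * (6%:R * (k%:R * l)) + (X == Y)%:R * k%:R ^+ 2.
  move=> hD; have [DF DY cD] := famP hD.
  apply: (le_trans (ler_sum _ (fun C => row D C hD))).
  rewrite big_split /= !sumr_const -[6%:R * _ *+ _]mulr_natl
    -[(X == Y)%:R * _ *+ _]mulr_natl; apply: lerD.
    rewrite ler_wpM2r ?ler_nat ?subset_leq_card ?subsetDl//.
    by rewrite !mulr_ge0// ltW.
  rewrite mulrCA ler_wpM2l// mulrA ler_piMl ?exprn_ge0// mulrA.
  have [->|] := posnP #|X :\: D|; first by rewrite invr0 mulr0.
  by rewrite -(ltr0n R) => p0; rewrite ler_pdivrMr// mul1r famD_le.
apply: (le_trans (ler_sum _ rowsum)).
rewrite sumr_const -[_ *+ _]mulr_natl mulrDr; apply: lerD.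
  have := square_error (ler0n R #|fam Y|) (fam_le X) (fam_le Y).
  by lra.
rewrite mulrCA; have [eXY|] := eqVneq X Y; last by rewrite !mul0r.
rewrite !mul1r expr2 mulrA mulrC ler_wpM2l// -eXY; exact: fam_le.
Qed.

End Pairs.
End PairSampling.

(** * Irregularity *)

Section Irreg.
Variables (R : realType) (T : finType) (adj : rel T).
Implicit Types (C D U W X Y : {set T}) (d : R).

Definition centered d (x y : T) : R := (adj x y)%:R - d.

Lemma edge_countE U W :
  (edge_count adj U W)%:R = \sum_(x in U) \sum_(y in W) (adj x y)%:R :> R.
Proof.
rewrite pair_big /= -[RHS]natr_sum; congr _%:R.
rewrite /edge_count -sum1_card big_mkcond [RHS]big_mkcond /=.
apply: eq_bigr => -[x y] _; rewrite !inE /=.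
by case: (x \in U); case: (y \in W); case: (adj x y).
Qed.

Lemma wt_centered d U W :
  wt (centered d) U W = (edge_count adj U W)%:R - #|U|%:R * #|W|%:R * d.
Proof.
rewrite edge_countE /wt /centered.
under eq_bigr do rewrite sumrB sumr_const.
by rewrite sumrB sumr_const -mulrnA -[d *+ _]mulr_natl natrM [_ * #|U|%:R]mulrC.
Qed.

Lemma edge_count_le U W : (edge_count adj U W <= #|U| * #|W|)%N.
Proof.
rewrite -cardsX; apply: subset_leq_card; apply/subsetP => p.
by rewrite inE => /andP[].
Qed.

Lemma edge_count_sub U W X Y : U \subset X -> W \subset Y ->
  (edge_count adj U W <= edge_count adj X Y)%N.
Proof.
move=> /subsetP UX /subsetP WY; apply: subset_leq_card; apply/subsetP => -[x y].
by rewrite !inE /= => /andP[/andP[/UX -> /WY ->] ->].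
Qed.

(** Monotonicity of the number of non-adjacent pairs, written additively to avoid truncated
    subtraction. *)
Lemma edge_count_compl U W X Y : U \subset X -> W \subset Y ->
  (edge_count adj X Y + #|U| * #|W| <= edge_count adj U W + #|X| * #|Y|)%N.
Proof.
move=> UX WY; rewrite -!cardsX -cardsUI addnC; apply: leq_add.
  apply: subset_leq_card; apply/subsetP => -[x y].
  by rewrite !inE /= => /andP[/andP[/andP[_ _] ->] ->].
apply: subset_leq_card; rewrite subUset; apply/andP; split; apply/subsetP => -[x y].
  by rewrite !inE /= => /andP[].
by rewrite !inE /= => /andP[/(subsetP UX) -> /(subsetP WY) ->].
Qed.

Lemma density_ge0 X Y : 0 <= density R adj X Y.
Proof. by rewrite divr_ge0// mulr_ge0. Qed.

Lemma density_le1 X Y : density R adj X Y <= 1.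
Proof.
rewrite /density -natrM; have [->|h] := posnP (#|X| * #|Y|)%N.
  by rewrite invr0 mulr0 ler01.
by rewrite ler_pdivrMr ?ltr0n// mul1r ler_nat edge_count_le.
Qed.

Lemma density_mul X Y :
  #|X|%:R * #|Y|%:R * density R adj X Y = (edge_count adj X Y)%:R.
Proof.
rewrite /density -natrM; have [h|h] := posnP (#|X| * #|Y|)%N.
  rewrite h mul0r; have := edge_count_le X Y; rewrite h leqn0 => /eqP ->.
  by [].
by rewrite mulrC divfK// pnatr_eq0 -lt0n.
Qed.

Lemma centered_le1 d x y : 0 <= d -> d <= 1 -> `|centered d x y| <= 1.
Proof.
move=> d0 d1; rewrite ler_norml /centered.
by case: adj; rewrite ?mulr1n ?mulr0n; apply/andP; split; lra.
Qed.

Lemma wt_density X Y : wt (centered (density R adj X Y)) X Y = 0.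
Proof. by rewrite wt_centered density_mul subrr. Qed.

Lemma irreg_ge0 X Y : 0 <= irreg R adj X Y.
Proof. exact: bigmax_ge_id. Qed.

Lemma irreg_le X Y (b : R) : 0 <= b ->
  (forall U W, U \subset X -> W \subset Y ->
     `|wt (centered (density R adj X Y)) U W| <= b) -> irreg R adj X Y <= b.
Proof.
move=> b0 h; apply: bigmax_le => // -[U W] /andP[UX WY].
by rewrite -wt_centered h.
Qed.

Lemma cut_le_irreg X Y :
  cut (centered (density R adj X Y)) X Y <= irreg R adj X Y.
Proof.
apply: cut_le => U W UX WY; rewrite wt_centered.
apply: (@le_bigmax_cond _ _ _ _ (U, W) _
  (fun p : {set T} * {set T} => `|(edge_count adj p.1 p.2)%:R
     - #|p.1|%:R * #|p.2|%:R * density R adj X Y|)).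
by rewrite /= UX.
Qed.

(** With [r] the ratio of [|U||W|] to [|X||Y|], the deviation from the true density is the weight of
    [(U, W)] minus [r] times that of [(X, Y)]. This allows [d] to be the density of the pair of
    parts when [X] and [Y] are pieces. *)
Lemma irreg_le_cut d X Y :
  irreg R adj X Y <= cut (centered d) X Y + `|wt (centered d) X Y|.
Proof.
have b0 : 0 <= cut (centered d) X Y + `|wt (centered d) X Y|.
  by rewrite addr_ge0 ?cut_ge0.
apply: irreg_le => // U W UX WY.
rewrite wt_centered.
have UW : (#|U| * #|W| <= #|X| * #|Y|)%N by rewrite leq_mul// subset_leq_card.
pose N : R := #|X|%:R * #|Y|%:R.
(* If [X] or [Y] is empty, division by zero makes [r] equal to 0, as required, since [|U||W|] is
   then 0 too. *)
have [r [r0 r1 hr]] : exists r : R, [/\ 0 <= r, r <= 1 & #|U|%:R * #|W|%:R = r * N].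
  exists (#|U|%:R * #|W|%:R / N); rewrite /N -!natrM.
  have [h|h] := posnP (#|X| * #|Y|)%N.
    have -> : (#|U| * #|W|)%N = 0%N by apply/eqP; rewrite -leqn0 -h.
    by rewrite h !mul0r.
  by rewrite divr_ge0 ?ler_pdivrMr ?ltr0n// ?mul1r ?ler_nat// divfK// pnatr_eq0 -lt0n.
have -> : (edge_count adj U W)%:R - #|U|%:R * #|W|%:R * density R adj X Y
    = wt (centered d) U W - r * wt (centered d) X Y.
  rewrite !wt_centered -(density_mul X Y) hr -/N; ring.
apply: (le_trans (ler_normB _ _)); apply: lerD; first exact: wt_le_cut.
by rewrite normrM (ger0_norm r0) ler_piMl.
Qed.

(** With [u = |U||W|] and [N = |X||Y|], the edge count lies between [max(0, u - (1 - d) N)] and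
    [min(u, d N)]. Both bounds differ from [u d] by at most [d (1 - d) N], and [hd] encodes
    [d (1 - d) <= 1/4]. *)
Lemma irreg_le_quarter X Y : irreg R adj X Y <= #|X|%:R * #|Y|%:R / 4%:R.
Proof.
apply: irreg_le => [|U W UX WY]; first by rewrite !mulr_ge0 ?invr_ge0.
have [h|h] := posnP (#|X| * #|Y|)%N.
  apply: (@le_trans _ _ (#|U|%:R * #|W|%:R)).
    apply: wt_le => x y; apply: centered_le1; [exact: density_ge0|exact: density_le1].
  have : (#|U| * #|W| <= #|X| * #|Y|)%N by rewrite leq_mul// subset_leq_card.
  by rewrite -!natrM h leqn0 => /eqP ->; rewrite mul0r.
rewrite wt_centered -!natrM.
have e1 := edge_count_le U W; have e2 := edge_count_sub UX WY.
have e3 := edge_count_compl UX WY.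
have dm := density_mul X Y.
move: e1 e2 e3; rewrite -!(ler_nat R) !natrD -dm natrM.
have d0 := density_ge0 X Y; have d1 := density_le1 X Y.
set d := density _ _ _ _ in d0 d1 *.
have N0 : 0 < #|X|%:R * #|Y|%:R :> R by rewrite -natrM ltr0n.
rewrite !natrM; set N := #|X|%:R * #|Y|%:R in N0 *.
set u := #|U|%:R * #|W|%:R.
have u0 : 0 <= u by rewrite mulr_ge0.
have p0 : 0 <= (edge_count adj U W)%:R :> R by [].
set p := _%:R in p0 *; move=> e1 e2 e3.
have hd : 0 <= (1 - 2%:R * d) ^+ 2 * N by rewrite mulr_ge0 ?sqr_ge0// ltW.
rewrite ler_norml; apply/andP; split.
  have [h1|h1] := lerP u ((1 - d) * N); clear dm.
    have := ler_wpM2r d0 h1; nra.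
  have : 0 <= (u - (1 - d) * N) * (1 - d) by rewrite mulr_ge0; lra.
  nra.
have [h1|h1] := lerP u (d * N).
  have : 0 <= (d * N - u) * (1 - d) by rewrite mulr_ge0; lra.
  nra.
have : 0 <= (u - d * N) * d by rewrite mulr_ge0; lra.
nra.
Qed.

(** * Effect of attaching at most one vertex to each piece *)

Section Attach.
Variables (d : R) (k : nat) (X Y C D : {set T}).
Hypotheses (d_ge0 : 0 <= d) (d_le1 : d <= 1) (CX : C \subset X) (DY : D \subset Y).
Hypotheses (Ck : #|C| = k) (Dk : #|D| = k).
Hypotheses (Xk : (#|X :\: C| <= 1)%N) (Yk : (#|Y :\: D| <= 1)%N).

Let wt_core U W : U \subset X -> W \subset Y ->
  `|wt (centered d) U W|
    <= `|wt (centered d) (U :&: C) (W :&: D)| + (2%:R * k%:R + 1).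
Proof.
move=> UX WY; set a := centered d.
have a1 x y : `|a x y| <= 1 by apply: centered_le1.
have e : wt a U W = wt a (U :&: C) (W :&: D) + wt a (U :&: C) (W :\: D)
    + wt a (U :\: C) W.
  rewrite /wt (big_setID C) /=; congr (_ + _); rewrite -big_split /=.
  by apply: eq_bigr => x _; rewrite (big_setID D).
rewrite e; apply: (le_trans (ler_normD _ _)).
have UC : (#|U :\: C| <= 1)%N.
  by apply: leq_trans Xk; apply: subset_leq_card; apply: setSD.
have WD : (#|W :\: D| <= 1)%N.
  by apply: leq_trans Yk; apply: subset_leq_card; apply: setSD.
have h1 : `|wt a (U :\: C) W| <= k%:R + 1.
  apply: (le_trans (wt_le a1 _ _)); rewrite natr1 -natrM ler_nat.
  rewrite -[leqRHS]mul1n leq_mul// -(cardsID D) -addn1 leq_add//.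
  by rewrite -Dk subset_leq_card// subsetIr.
have h2 : `|wt a (U :&: C) (W :\: D)| <= k%:R.
  apply: (le_trans (wt_le a1 _ _)); rewrite -natrM ler_nat.
  rewrite -[leqRHS]muln1 leq_mul//.
  by rewrite -Ck subset_leq_card// subsetIr.
have := ler_normD (wt a (U :&: C) (W :&: D)) (wt a (U :&: C) (W :\: D)).
by move: h1 h2; lra.
Qed.

(** The extra row has at most [k + 1] entries and the extra column at most [k], so any rectangle
    changes by at most [2 k + 1]. This is paid once for the cut norm and once for the total
    weight. *)
Lemma irreg_le_core :
  irreg R adj X Y <= cut (centered d) C D + `|wt (centered d) C D|
     + (4%:R * k%:R + 2%:R).
Proof.
apply: (le_trans (irreg_le_cut d X Y)).
have h1 : cut (centered d) X Y <= cut (centered d) C D + (2%:R * k%:R + 1).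
  apply: cut_le => U W UX WY; apply: (le_trans (wt_core UX WY)).
  by rewrite lerD2r wt_le_cut// subsetIr.
have := wt_core (subxx X) (subxx Y).
by rewrite (setIidPr CX) (setIidPr DY); move: h1; lra.
Qed.

End Attach.
End Irreg.

(** * Packings by sets of equal size *)

Section Packing.
Variables (T : finType) (k K : nat).
Hypothesis k_gt0 : (0 < k)%N.
Implicit Types (A B C D X : {set T}) (F P : {set {set T}}).
Local Open Scope nat_scope.

Definition packing F := trivIset F && [forall B in F, #|B| == k].

Lemma packing_triv F : packing F -> trivIset F.
Proof. by case/andP. Qed.

Lemma packing_card F B : packing F -> B \in F -> #|B| = k.
Proof. by case/andP => _ /forall_inP h /h /eqP. Qed.

Lemma card_cover_packing F : packing F -> #|cover F| = #|F| * k.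
Proof.
move=> pF; have /eqP <- := packing_triv pF; rewrite -sum_nat_const.
by apply: eq_bigr => B; apply: packing_card.
Qed.

Lemma subset_card_ex A : k <= #|A| -> exists2 B : {set T}, B \subset A & #|B| = k.
Proof.
move=> h; have [s [us ss sA]] := card_geqP h; exists [set x in s].
  by apply/subsetP => x; rewrite inE => /sA.
by rewrite cardsE (card_uniqP us).
Qed.

(** Take a packing maximal under inclusion: a part with [k] uncovered vertices would provide one
    more set. *)
Lemma packing_maximal P F0 : packing F0 -> #|F0| <= K ->
  (forall B, B \in F0 -> exists2 X : {set T}, X \in P & B \subset X) ->
  exists F, [/\ F0 \subset F, packing F, #|F| <= K,
    forall B, B \in F -> exists2 X : {set T}, X \in P & B \subset X &
    #|F| < K -> forall X, X \in P -> #|X :\: cover F| < k].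
Proof.
move=> pF0 cF0 hF0.
pose p F := [&& packing F, #|F| <= K & [forall B in F, [exists X in P, B \subset X]]].
have p0 : p F0.
  by apply/and3P; split => //; apply/forall_inP => B /hF0 h; apply/exists_inP.
have [F /maxsetP[/and3P[pF cF /forall_inP hF] maxF] F0F] := maxset_exists p0.
exists F; split=> // [B /hF /exists_inP //|ltF X XP].
rewrite ltnNge; apply/negP => /subset_card_ex[B].
rewrite subsetD => /andP[BX dB] cB.
have n0 : set0 \notin F.
  by apply/negP => /(packing_card pF); rewrite cards0 => k0; move: k_gt0; rewrite -k0.
have [tBF nBF] : trivIset (B |: F) /\ B \notin F.
  by apply: trivIsetU1 (packing_triv pF) n0; apply/bigcup_disjointP.
have pB : p (B |: F).
  apply/and3P; split; last 2 first.
  - by rewrite cardsU1 nBF.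
  - apply/forall_inP => C /setU1P[->|/hF //].
    by apply/exists_inP; exists X.
  rewrite /packing tBF; apply/forall_inP => C /setU1P[->|CF]; first exact/eqP.
  by rewrite (packing_card pF CF).
by move: nBF; rewrite -(maxF _ pB (subsetUr _ _)) setU11.
Qed.

(** If the packing stops before [K] sets, every part has fewer than [k] uncovered vertices. Counting
    vertices then shows that at most [#|P|] sets are missing. *)
Lemma packing_in_partition P : partition P [set: T] -> K * k <= #|T| ->
  exists F, [/\ packing F, #|F| <= K,
    forall B, B \in F -> exists2 X : {set T}, X \in P & B \subset X & K <= #|F| + #|P|].
Proof.
move=> partP hK.
have p0 : packing set0.
  apply/andP; split; last by apply/forall_inP => B; rewrite inE.
  by apply/trivIsetP => A B; rewrite inE.
have [||F [_ pF cF hF maxF]] := @packing_maximal P set0 p0.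
- by rewrite cards0.
- by move=> B; rewrite inE.
exists F; split=> //.
have [ltF|?] := ltnP #|F| K; last by rewrite (leq_trans _ (leq_addr _ _)).
rewrite -(leq_pmul2r k_gt0) mulnDl -(card_cover_packing pF).
apply: (leq_trans hK); rewrite -cardsT -(cardsID (cover F) [set: T]) setTI leq_add2l.
rewrite -sum_nat_const.
apply: (@leq_trans (\sum_(X in P) #|X :\: cover F|)); last first.
  by apply: leq_sum => X XP; apply: ltnW; apply: maxF.
have -> : [set: T] :\: cover F = \bigcup_(X in P) (X :\: cover F).
  apply/setP => x; apply/setDP/bigcupP => [[_ xF]|[X XP /setDP[_ ?]]]; last by rewrite inE.
  have : x \in cover P by rewrite (cover_partition partP) inE.
  by case/bigcupP => X XP xX; exists X => //; rewrite inE xF.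
elim/big_rec2: _ => [|X n U _ h]; first by rewrite cards0.
by apply: (leq_trans (leq_card_setU _ _)); rewrite leq_add2l.
Qed.

(** Apply [packing_maximal] with the whole vertex set as the only part: the new pieces may mix the
    remainders of different parts. *)
Lemma packing_complete F0 : packing F0 -> #|F0| <= K -> K * k <= #|T| ->
  exists F, [/\ F0 \subset F, packing F & #|F| = K].
Proof.
move=> pF0 cF0 hK.
have [|F [F0F pF cF _ maxF]] := @packing_maximal [set [set: T]] F0 pF0 cF0.
  by move=> B _; exists [set: T]; rewrite ?inE// subsetT.
exists F; split=> //; apply/eqP; rewrite eqn_leq cF leqNgt; apply/negP => ltF.
have := maxF ltF _ (set11 _); rewrite ltnNge => /negP; apply.
rewrite cardsD setTI (card_cover_packing pF) cardsT leq_subRL.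
  by rewrite addnC -mulSn (leq_trans _ hK)// leq_mul2r ltF orbT.
by rewrite (leq_trans _ hK)// leq_mul2r cF orbT.
Qed.

(** At most [#|F|] vertices are uncovered; each joins the set of [F] that has the same rank in its
    enumeration. *)
Lemma packing_attach F : packing F -> #|T| <= #|F| * k + #|F| ->
  exists q : {set T} -> {set T}, [/\
    forall C, C \in F -> C \subset q C /\ #|q C :\: C| <= 1,
    {in F &, forall C D, C != D -> [disjoint q C & q D]} &
    \bigcup_(C in F) q C = [set: T]].
Proof.
move=> pF hT; set E := ~: cover F.
have cE : #|E| <= #|F|.
  have := cardsC (cover F); rewrite (card_cover_packing pF) -/E => e.
  by rewrite -(leq_add2l (#|F| * k)) e.
pose att C := [set x in E | index x (enum E) == index C (enum F)].
have attE C x : x \in att C -> x \in E by rewrite inE => /andP[].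
have FE C x : C \in F -> x \in C -> x \notin E.
  by move=> CF xC; rewrite inE negbK; apply/bigcupP; exists C.
have idxE x y : x \in E -> y \in E -> index x (enum E) = index y (enum E) -> x = y.
  move=> xE yE e; rewrite -(nth_index x (s := enum E) (x := x)) ?mem_enum//.
  by rewrite e nth_index ?mem_enum.
have idxF C D : C \in F -> D \in F -> index C (enum F) = index D (enum F) -> C = D.
  move=> xE yE e; rewrite -(nth_index C (s := enum F) (x := C)) ?mem_enum//.
  by rewrite e nth_index ?mem_enum.
exists (fun C => C :|: att C); split.
- move=> C CF; split; first exact: subsetUl.
  rewrite setDUl setDv set0U (leq_trans (subset_leq_card (subsetDl _ _)))//.
  apply/card_le1_eqP => x y xC yC.
  apply: esym; apply: idxE (attE _ _ xC) (attE _ _ yC) _.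
  by move: xC yC; rewrite !inE => /andP[_ /eqP ->] /andP[_ /eqP ->].
- move=> C D CF DF nCD; rewrite -setI_eq0; apply/eqP/setP => x.
  rewrite [RHS]inE; apply/negbTE/negP => /setIP[/setUP xC /setUP xD].
  case: xC => xC; case: xD => xD.
  + have := packing_triv pF => /trivIsetP /(_ C D CF DF nCD) d.
    by rewrite (disjointFr d xC) in xD.
  + by have := FE _ _ CF xC; rewrite (attE _ _ xD).
  + by have := FE _ _ DF xD; rewrite (attE _ _ xC).
  + case/eqP: nCD; apply: idxF => //.
    by move: xC xD; rewrite !inE => /andP[_ /eqP <-] /andP[_ /eqP <-].
- apply/setP => x; rewrite [RHS]inE; apply/bigcupP.
  have [xE|] := boolP (x \in E); last first.
    by rewrite inE negbK => /bigcupP[C CF xC]; exists C; rewrite // inE xC.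
  have lt : index x (enum E) < size (enum F).
    by rewrite -cardE (leq_trans _ cE)// cardE index_mem mem_enum.
  exists (nth set0 (enum F) (index x (enum E))).
    by rewrite -mem_enum mem_nth.
  apply/setUP; right; rewrite inE xE index_uniq ?enum_uniq//.
  exact/eqP.
Qed.

End Packing.

Lemma partition_imset (T : finType) (F : {set {set T}}) (q : {set T} -> {set T})
    (s : {perm T}) :
  (forall C, C \in F -> q C != set0) ->
  {in F &, forall C D, C != D -> [disjoint q C & q D]} ->
  \bigcup_(C in F) q C = [set: T] ->
  partition [set s @: q C | C in F] [set: T] /\
    {in F &, injective (fun C => s @: q C)}.
Proof.
move=> q0 dq covq.
have inj : {in F &, injective (fun C => s @: q C)}.
  move=> C D CF DF /= /(imset_inj (@perm_inj _ s)) e; apply/eqP/negPn/negP => nCD.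
  have := dq _ _ CF DF nCD; rewrite e -setI_eq0 setIid => /eqP h.
  by have := q0 _ DF; rewrite h eqxx.
split=> //; apply/and3P; split.
- rewrite eqEsubset subsetT; apply/subsetP => x _.
  have : (s^-1)%g x \in \bigcup_(C in F) q C by rewrite covq inE.
  case/bigcupP => C CF xC; apply/bigcupP; exists (s @: q C); first exact: imset_f.
  by apply/imsetP; exists ((s^-1)%g x); rewrite ?permKV.
- apply/trivIsetP => _ _ /imsetP[C CF ->] /imsetP[D DF ->] nCD.
  rewrite -setI_eq0 -imsetI; last by move=> ? ? _ _; apply: perm_inj.
  rewrite imset_eq0 setI_eq0; apply: dq => //.
  by apply: contraNneq nCD => ->.
- apply/negP => /imsetP[C CF] /esym/eqP; rewrite imset_eq0.
  by apply/negP/q0.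
Qed.

(** * Summation over pairs of pieces *)

Section GoodPairs.
Variables (R : realType) (T : finType) (J : eqType) (c : T -> J) (adj : rel T).
Variables (F : {set {set T}}) (q : {set T} -> {set T}) (k : nat) (l : R).
Variables (X Y : {set T}) (i j : J).
Hypotheses (pF : packing k F) (l_ge1 : 1 <= l) (l_sqr : l ^+ 2 = k%:R).
Hypothesis q_core : forall C, C \in F -> C \subset q C /\ (#|q C :\: C| <= 1)%N.
Hypotheses (Xi : color_class c X i) (Yj : color_class c Y j).

(** Apply [irreg_le_core] with the density of [(X, Y)], then [cut_pairs] and [wt_pairs]. The
    constant is 16 = 4 + 6 + 6. The last 6 pays for the attached vertices: [4 k + 2 <= 6 k] on at
    most [|X||Y| / k^2] pairs, and [l <= k]. *)
Lemma avg_irreg_pairs :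
  avg c (fun s => \sum_(D in [set B in F | B \subset Y])
      \sum_(C in [set B in F | B \subset X] :\ D) irreg R adj (s @: q C) (s @: q D))
    <= irreg R adj X Y + 16%:R * (#|X|%:R * #|Y|%:R / l)
       + (X == Y)%:R * (k%:R * #|X|%:R).
Proof.
set FX := [set B in F | B \subset X]; set FY := [set B in F | B \subset Y].
pose d := density R adj X Y; pose a := centered adj d.
have d0 : 0 <= d := density_ge0 R adj X Y; have d1 : d <= 1 := density_le1 R adj X Y.
have a1 x y : `|a x y| <= 1 by apply: centered_le1.
have l0 : 0 < l by apply: lt_le_trans l_ge1.
have famP (A B : {set T}) : B \in [set B in F | B \subset A] -> [/\ B \in F, B \subset A & #|B| = k].
  by rewrite inE => /andP[BF BA]; split => //; apply: packing_card pF BF.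
have tF : trivIset F := packing_triv pF.
have cF A : A \in F -> #|A| = k by apply: packing_card.
have fam_le (A : {set T}) : #|[set B in F | B \subset A]|%:R * k%:R <= #|A|%:R :> R.
  have tA : trivIset [set B in F | B \subset A].
    by apply: trivIsetS tF; apply/subsetP => B /famP[].
  rewrite -natrM ler_nat; apply: card_packing tA _ => B.
  by case/famP.
have core (s : {perm T}) D C : D \in FY -> C \in FX :\ D ->
    irreg R adj (s @: q C) (s @: q D)
    <= cut a (s @: C) (s @: D) + `|wt a (s @: C) (s @: D)| + (4%:R * k%:R + 2%:R).
  move=> /famP[DF _ cD] /setD1P[_ /famP[CF _ cC]].
  have img A : A \in F -> s @: A \subset s @: q A /\ (#|s @: q A :\: s @: A| <= 1)%N.
    move=> AF; have [Aq hA] := q_core AF; split; first exact: imsetS.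
    rewrite cardsD (setIidPr (imsetS _ Aq)) !card_imset; try exact: perm_inj.
    by move: hA; rewrite cardsD (setIidPr Aq).
  have [h1 h2] := img _ CF; have [h3 h4] := img _ DF.
  apply: irreg_le_core => //; rewrite card_imset//; exact: perm_inj.
apply: (@le_trans _ _ (avg c (fun s => \sum_(D in FY) \sum_(C in FX :\ D)
   (cut a (s @: C) (s @: D) + `|wt a (s @: C) (s @: D)| + (4%:R * k%:R + 2%:R))))).
  by apply: avg_le => s _; apply: ler_sum => D hD; apply: ler_sum => C; apply: core.
have -> : avg c (fun s => \sum_(D in FY) \sum_(C in FX :\ D)
   (cut a (s @: C) (s @: D) + `|wt a (s @: C) (s @: D)| + (4%:R * k%:R + 2%:R)))
   = \sum_(D in FY) \sum_(C in FX :\ D) avg c (fun s => cut a (s @: C) (s @: D))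
   + \sum_(D in FY) \sum_(C in FX :\ D) avg c (fun s => `|wt a (s @: C) (s @: D)|)
   + \sum_(D in FY) \sum_(C in FX :\ D) (4%:R * k%:R + 2%:R).
  rewrite avg_sum -!big_split /=; apply: eq_bigr => D _.
  rewrite avg_sum -!big_split /=; apply: eq_bigr => C _.
  by rewrite avgD avgD avg_cst.
have h1 := cut_pairs a1 tF cF Xi Yj l0 l_sqr.
have h2 := wt_pairs a1 tF cF Xi Yj l0 l_sqr (wt_density R adj X Y).
have h3 := cut_le_irreg R adj X Y.
have h4 : \sum_(D in FY) \sum_(C in FX :\ D) (4%:R * k%:R + 2%:R)
    <= 6%:R * (#|X|%:R * #|Y|%:R / l).
  have k1 : 1 <= k%:R :> R by rewrite -l_sqr exprn_ege1.
  apply: (@le_trans _ _ (\sum_(D in FY) \sum_(C in FX) (6%:R * k%:R))).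
    apply: ler_sum => D _; rewrite [leRHS](big_setID [set D]) /=.
    rewrite -[leLHS]add0r; apply: lerD; first by apply: sumr_ge0 => ? _; lra.
    by apply: ler_sum => ? _; lra.
  rewrite sumr_const sumr_const -mulrnA -[_ *+ _]mulr_natl natrM.
  rewrite -subr_ge0 -(pmulr_rge0 _ l0).
  have -> : l * (6%:R * (#|X|%:R * #|Y|%:R / l) - #|FX|%:R * #|FY|%:R * (6%:R * k%:R))
      = 6%:R * (#|X|%:R * #|Y|%:R - l * (#|FX|%:R * #|FY|%:R * k%:R)).
    by field; lra.
  rewrite mulr_ge0// subr_ge0.
  have hp : 0 <= #|FX|%:R * #|FY|%:R * k%:R :> R by rewrite !mulr_ge0.
  apply: (@le_trans _ _ (k%:R * (#|FX|%:R * #|FY|%:R * k%:R))).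
    by rewrite ler_wpM2r// -l_sqr expr2 ler_peMl// ltW.
  rewrite (_ : k%:R * _ = #|FX|%:R * k%:R * (#|FY|%:R * k%:R)); last by ring.
  by apply: ler_pM; rewrite ?mulr_ge0// fam_le.
move: h1 h2 h3 h4; rewrite -/d -/a -/FX -/FY.
set s1 := \sum_(D in FY) _; set s2 := \sum_(D in FY) _; set s3 := \sum_(D in FY) _.
set u := _ / l; set v := _%:R * (_ * _); set w := irreg _ _ _ _; set z := cut _ _ _.
by clearbody s1 s2 s3 u v w z; lra.
Qed.

End GoodPairs.

Section Split.
Variables (R : realType) (T : finType) (P F F0 : {set {set T}}).
Hypotheses (F0F : F0 \subset F)
  (F0P : forall B, B \in F0 -> exists2 X : {set T}, X \in P & B \subset X).

Lemma sum_split_parts (g : {set T} -> R) : (forall C, 0 <= g C) ->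
  \sum_(C in F0) g C <= \sum_(X in P) \sum_(C in [set B in F0 | B \subset X]) g C.
Proof.
move=> g0.
under [leRHS]eq_bigr => X _ do rewrite big_mkcond /=.
rewrite [leLHS]big_mkcond exchange_big /=; apply: ler_sum => C _.
case: ifP => CF0; last by apply: sumr_ge0 => X _; case: ifP.
have [X XP CX] := F0P CF0.
rewrite (bigD1 X)//= inE CF0 CX lerDl; apply: sumr_ge0 => Z _; by case: ifP.
Qed.

(** The exceptional pairs have a piece outside [F0] or two equal pieces. They are charged [b]
    each. *)
Lemma sum_pairs_split (g : {set T} -> {set T} -> R) (b : R) :
  (forall C D, 0 <= g C D) -> (forall C D, C \in F -> D \in F -> g C D <= b) ->
  0 <= b ->
  \sum_(C in F) \sum_(D in F) g C D
    <= \sum_(X in P) \sum_(Y in P) \sum_(D in [set B in F0 | B \subset Y])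
         \sum_(C in [set B in F0 | B \subset X] :\ D) g C D
       + (2%:R * #|F :\: F0|%:R * #|F|%:R + #|F|%:R) * b.
Proof.
move=> g0 gb b0.
pose good C D := if (C \in F0) && (D \in F0) && (C != D) then g C D else 0.
have good0 C D : 0 <= good C D by rewrite /good; case: ifP.
have pt C D : C \in F -> D \in F ->
    g C D <= good C D + ((C \notin F0)%:R * b + (D \notin F0)%:R * b + (C == D)%:R * b).
  move=> CF DF; have := gb _ _ CF DF; have := g0 C D; rewrite /good.
  by case: (C \in F0); case: (D \in F0); case: (C == D);
    rewrite /= ?mulr1n ?mulr0n ?mul1r ?mul0r; lra.
apply: (@le_trans _ _ (\sum_(C in F) \sum_(D in F) (good C D
    + ((C \notin F0)%:R * b + (D \notin F0)%:R * b + (C == D)%:R * b)))).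
  by apply: ler_sum => C CF; apply: ler_sum => D DF; apply: pt.
under eq_bigr do rewrite !big_split /=.
rewrite !big_split /=; apply: lerD.
  apply: (@le_trans _ _ (\sum_(D in F0) \sum_(C in F0) good C D)).
    rewrite exchange_big /= (big_setID F0) /= (setIidPr F0F) [X in _ + X]big1 ?addr0.
      apply: ler_sum => D _; rewrite (big_setID F0) /= (setIidPr F0F).
      rewrite [X in _ + X]big1 ?addr0// => C /setDP[_ /negbTE CF0].
      by rewrite /good CF0.
    move=> D /setDP[_ /negbTE DF0]; apply: big1 => C _.
    by rewrite /good DF0 andbF.
  apply: (@le_trans _ _ (\sum_(Y in P) \sum_(D in [set B in F0 | B \subset Y])
       \sum_(X in P) \sum_(C in [set B in F0 | B \subset X]) good C D)).
    apply: (@le_trans _ _ (\sum_(D in F0) \sum_(X in P)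
        \sum_(C in [set B in F0 | B \subset X]) good C D)).
      by apply: ler_sum => D _; apply: sum_split_parts.
    apply: sum_split_parts => D; apply: sumr_ge0 => X _; exact: sumr_ge0.
  rewrite [leRHS]exchange_big /=; apply: ler_sum => Y _.
  rewrite [leLHS]exchange_big /=; apply: ler_sum => X _; apply: ler_sum => D hD.
  rewrite (big_setID [set D]) /= [X in X + _]big1 ?add0r => [|C].
    apply: ler_sum => C _; rewrite /good.
    by case: ifP.
  by move=> /setIP[_ /set1P ->]; rewrite /good eqxx andbF.
have e1 : \sum_(C in F) (C \notin F0)%:R = #|F :\: F0|%:R :> R.
  rewrite -natr_sum; congr _%:R; rewrite -sum1_card.
  rewrite big_mkcond [RHS]big_mkcond; apply: eq_bigr => C _.
  by rewrite inE andbC; case: (C \in F); case: (C \in F0).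
rewrite !mulrDl; apply: lerD; last first.
  rewrite mulr_natl -sumr_const; apply: ler_sum => C CF.
  rewrite -mulr_suml (bigD1 C)//= eqxx big1 ?addr0 ?mul1r// => D /andP[_ nDC].
  by rewrite eq_sym (negbTE nDC).
have -> : \sum_(C in F) \sum_(D in F) (D \notin F0)%:R * b
    = #|F|%:R * (#|F :\: F0|%:R * b).
  under eq_bigr do rewrite -mulr_suml e1.
  by rewrite sumr_const [RHS]mulr_natl.
have -> : \sum_(C in F) \sum_(D in F) (C \notin F0)%:R * b
    = #|F|%:R * (#|F :\: F0|%:R * b).
  rewrite exchange_big /=.
  under eq_bigr do rewrite -mulr_suml e1.
  by rewrite sumr_const [RHS]mulr_natl.
by lra.
Qed.

End Split.

(** * Choice of the constants *)

(** The three terms use at most the fractions [1/4], [2/7] and [27/128 * (1001/1000)^2] of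
    [alpha * n ^+ 2], which together stay below 1. *)
Lemma error_budget (R : realFieldType) (alpha m K k l n : R) :
  0 < alpha -> alpha < 1 / 2%:R -> 1 <= m -> 8%:R <= K ->
  4%:R * m <= alpha * (K + 1) -> 0 < l -> l ^+ 2 = k ->
  4096%:R <= k * alpha ^+ 2 -> K * k <= n ->
  16%:R * (n ^+ 2 / l) + k * n + (2%:R * m * K + K) * ((k + 1) ^+ 2 / 4%:R)
    <= alpha * n ^+ 2.
Proof.
move=> a0 a1 m1 K8 mK l0 lk ka Kn.
have k0 : 0 < k by rewrite -lk exprn_gt0.
have n0 : 0 < n by apply: lt_le_trans Kn; rewrite mulr_gt0//; lra.
have la : 64%:R <= l * alpha.
  have : 64%:R ^+ 2 <= (l * alpha) ^+ 2 by rewrite exprMn lk; lra.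
  by rewrite ler_pXn2r// ?nnegrE ?mulr_ge0// ltW.
have h1 : 16%:R * (n ^+ 2 / l) <= alpha * n ^+ 2 / 4%:R.
  rewrite mulrA ler_pdivrMr//.
  have := ler_wpM2l (sqr_ge0 n) la; lra.
have h2 : k * n <= (2%:R / 7%:R) * alpha * n ^+ 2.
  have : k <= (2%:R / 7%:R) * alpha * n.
    (* From [4 m <= alpha (K + 1)] with [1 <= m] and [alpha < 1/2]: [alpha K >= 4 - 1/2]. *)
    have Ka : 7%:R / 2%:R <= alpha * K by lra.
    have := ler_wpM2r (ltW k0) Ka.
    have := ler_wpM2l (ltW a0) Kn; lra.
  by move=> /(ler_wpM2r (ltW n0)); lra.
have k1000 : 1000%:R <= k.
  have : alpha ^+ 2 <= 1 by nra.
  by move=> /(ler_wpM2l (ltW k0)); lra.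
have hK1 : 1000%:R * (K * (k + 1)) <= 1001%:R * n.
  by have := ler_wpM2l (_ : 0 <= K) k1000; lra.
have h3 : (2%:R * m * K + K) * ((k + 1) ^+ 2 / 4%:R)
    <= (27%:R / 128%:R) * alpha * (K * (k + 1)) ^+ 2.
  have -> : (27%:R / 128%:R) * alpha * (K * (k + 1)) ^+ 2
      = (27%:R / 32%:R) * alpha * K * K * ((k + 1) ^+ 2 / 4%:R) by field.
  rewrite ler_wpM2r ?divr_ge0 ?sqr_ge0//.
  (* As [8 <= K], [K + 1] is at most [9/8 * K]. The 3 comes from [2 m K + K <= 3 m K]. *)
  have mb : 3%:R * m <= (27%:R / 32%:R) * alpha * K.
    have := ler_wpM2l (ltW a0) K8; lra.
  have := ler_wpM2r (_ : 0 <= K) mb => /(_ ltac:(lra)).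
  have := ler_wpM2r (_ : 0 <= K) m1 => /(_ ltac:(lra)).
  by lra.
have h4 : (1000%:R * (K * (k + 1))) ^+ 2 <= (1001%:R * n) ^+ 2.
  rewrite ler_pXn2r// ?nnegrE ?mulr_ge0//; lra.
have h5 : alpha * (K * (k + 1)) ^+ 2 <= alpha * (1001%:R / 1000%:R * n) ^+ 2.
  by rewrite ler_pM2l//; lra.
have h6 : 0 <= alpha * n ^+ 2 by rewrite mulr_ge0 ?sqr_ge0// ltW.
by move: h1 h2 h3 h5 h6; lra.
Qed.

(** Combining the bounds on [n] and [K] gives [10^8 m <= 4 m (k + 1) alpha^4]. Since
    [alpha^2 <= 1/4], the quantity [(k + 1) alpha^2] is at least [10^8], far above what is
    needed. *)
Lemma part_size_lower_bound (R : realFieldType) (alpha m K k n : R) :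
  0 < alpha -> alpha < 1 / 2%:R -> 1 <= m -> 0 <= k ->
  alpha * K <= 4%:R * m -> 10%:R ^+ 8 * m * alpha ^- 5 <= n -> n <= K * (k + 1) ->
  4096%:R <= k * alpha ^+ 2.
Proof.
move=> a0 a1 m1 k0 aK hn nK.
have a50 : 0 < alpha ^+ 5 by rewrite exprn_gt0.
rewrite ler_pdivrMr// in hn.
have h1 : 10%:R ^+ 8 * m <= 4%:R * m * (k + 1) * alpha ^+ 4.
  apply: (le_trans hn).
  have := ler_wpM2r (ltW a50) nK.
  have q0 : 0 <= (k + 1) * alpha ^+ 4 by rewrite mulr_ge0 ?exprn_ge0//; lra.
  by have := ler_wpM2r q0 aK; lra.
have h2 : 10%:R ^+ 8 <= 4%:R * (k + 1) * alpha ^+ 4.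
  have m0 : 0 < m by lra.
  by rewrite -(ler_pM2l m0); lra.
have a2 : 0 <= alpha ^+ 2 <= 4%:R^-1 by apply/andP; split; nra.
case/andP: a2 => a20 a21.
have h3 : 4%:R * (k + 1) * alpha ^+ 4 <= (k + 1) * alpha ^+ 2.
  have q0 : 0 <= (k + 1) * alpha ^+ 2 by rewrite mulr_ge0//; lra.
  by have := ler_wpM2l q0 a21; lra.
by move: h2 h3 a21; lra.
Qed.

(** * Assembly of the partition and choice of the permutation *)

Theorem theorem2p1 (R : realType) (alpha : R) (m : nat)
    (T : finType) (adj : rel T) (P : {set {set T}})
    (alpha_gt0 : 0 < alpha) (alpha_lt : alpha < 1 / 2%:R)
    (m_gt0 : (0 < m)%N)
    (adj_sym : symmetric adj) (adj_irr : irreflexive adj)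
    (n_large : 10%:R ^+ 8 * m%:R * alpha ^- 5 <= #|T|%:R)
    (P_part : partition P [set: T]) (P_card : #|P| = m) :
  exists Q : {set {set T}},
    [/\ partition Q [set: T],
        equitable Q,
        #|Q|%:R <= 4%:R * m%:R / alpha &
        irreg_partition R adj Q
          <= irreg_partition R adj P + alpha * #|T|%:R ^+ 2].
Proof.
(* [K] is the largest number of pieces allowed; since [alpha < 1/2], it is at least 8. *)
pose x : R := 4%:R * m%:R / alpha; pose K := Num.trunc x.
have m1 : 1 <= m%:R :> R by rewrite ler1n.
have x0 : 0 <= x by rewrite divr_ge0 ?mulr_ge0// ltW.
have /andP[Kx xK] := truncn_itv x0; rewrite -/K in Kx xK.
have aK : alpha * K%:R <= 4%:R * m%:R by rewrite mulrC -ler_pdivlMr.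
have mK : 4%:R * m%:R <= alpha * (K%:R + 1).
  by rewrite [leRHS]mulrC -ler_pdivrMr// natr1 ltW.
have K8 : (8 <= K)%N.
  rewrite -ltnS -(ltr_nat R); apply: le_lt_trans xK.
  by rewrite ler_pdivlMr//; lra.
have K0 : (0 < K)%N by apply: leq_trans K8.
pose k := (#|T| %/ K)%N.
have Kk : (K * k <= #|T|)%N by rewrite mulnC leq_trunc_div.
have TK : (#|T| <= K * k + K)%N.
  by rewrite {1}(divn_eq #|T| K) -/k mulnC leq_add2l ltnW// ltn_mod.
have ka : 4096%:R <= k%:R * alpha ^+ 2.
  apply: (part_size_lower_bound alpha_gt0 alpha_lt m1 (ler0n _ _) aK n_large).
  by rewrite natr1 -natrM ler_nat mulnS addnC.
have k0 : (0 < k)%N.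
  by rewrite lt0n; apply/eqP => k0; rewrite k0 mul0r in ka; lra.
pose l : R := Num.sqrt k%:R.
have l_sqr : l ^+ 2 = k%:R by rewrite sqr_sqrtr.
have l1 : 1 <= l by rewrite -(sqrtr1 R) ler_sqrt ?ler1n.
(* The sets of [F0] lie inside parts of [P]; [F] adds at most [m] remainder pieces, and [q] attaches
   the vertices still uncovered. *)
have [F0 [pF0 cF0 F0P cF0P]] := packing_in_partition k0 P_part Kk.
have [F [F0F pF cF]] := packing_complete k0 pF0 cF0 Kk.
have [|q [q_core q_disj q_cov]] := packing_attach pF; first by rewrite cF.
have q_card C : C \in F -> (k <= #|q C| <= k + 1)%N.
  move=> CF; have [Cq hq] := q_core _ CF; rewrite -(packing_card pF CF).
  rewrite subset_leq_card//=; move: hq; rewrite cardsD (setIidPr Cq).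
  by rewrite leq_subLR addnC.
have q_neq0 C : C \in F -> q C != set0.
  by move=> CF; rewrite -card_gt0; case/andP: (q_card _ CF) => h _; apply: leq_trans h.
pose c := pblock P.
have P_class X : X \in P -> color_class c X X.
  move=> XP z; have tP := partition_trivIset P_part.
  apply/idP/eqP => [|<-]; first exact: def_pblock.
  by rewrite mem_pblock (cover_partition P_part) inE.
have F0_core C : C \in F0 -> C \subset q C /\ (#|q C :\: C| <= 1)%N.
  by move=> /(subsetP F0F); apply: q_core.
(* Only pairs of distinct pieces from [F0] are averaged. The other pairs are bounded for every [s]
   by [irreg_le_quarter], so one [s] with [S s] at most its average suffices. *)
pose S (s : {perm T}) := \sum_(X in P) \sum_(Y in P)
  \sum_(D in [set B in F0 | B \subset Y])
    \sum_(C in [set B in F0 | B \subset X] :\ D) irreg R adj (s @: q C) (s @: q D).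
have sumX : \sum_(X in P) #|X|%:R = #|T|%:R :> R.
  by rewrite -natr_sum -(card_partition P_part) cardsT.
have avgS : avg c S <= irreg_partition R adj P
    + 16%:R * (#|T|%:R ^+ 2 / l) + k%:R * #|T|%:R.
  apply: (@le_trans _ _ (\sum_(X in P) \sum_(Y in P) (irreg R adj X Y
      + 16%:R * (#|X|%:R * #|Y|%:R / l) + (X == Y)%:R * (k%:R * #|X|%:R)))).
    rewrite avg_sum; apply: ler_sum => X XP; rewrite avg_sum; apply: ler_sum => Y YP.
    exact: avg_irreg_pairs pF0 l1 l_sqr F0_core (P_class _ XP) (P_class _ YP).
  under eq_bigr do rewrite !big_split /=.
  rewrite !big_split /= -/(irreg_partition _ _ _) -!addrA lerD2l; apply: lerD.
    under eq_bigr do rewrite -mulr_sumr -mulr_suml -mulr_sumr sumX.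
    by rewrite -mulr_sumr -!mulr_suml sumX expr2.
  rewrite -sumX mulr_sumr; apply: ler_sum => X XP.
  by rewrite -mulr_suml (bigD1 X)//= eqxx big1 ?addr0 ?mul1r// => Y /andP[_ /negbTE];
    rewrite eq_sym => ->.
have [s sG hs] := avg_ex c S.
have [Q_part q_inj] := partition_imset s q_neq0 q_disj q_cov.
exists [set s @: q C | C in F]; split => //.
- move=> _ _ /imsetP[C CF ->] /imsetP[D DF ->].
  rewrite !card_imset; try exact: perm_inj.
  case/andP: (q_card _ CF) => _ h1; case/andP: (q_card _ DF) => h2 _.
  by rewrite (leq_trans h1)// leq_add2r.
- apply: le_trans Kx; rewrite ler_nat -cF; exact: leq_imset_card.
have b0 : 0 <= (k%:R + 1) ^+ 2 / 4%:R :> R by rewrite divr_ge0 ?sqr_ge0.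
have gb C D : C \in F -> D \in F ->
    irreg R adj (s @: q C) (s @: q D) <= (k%:R + 1) ^+ 2 / 4%:R.
  move=> CF DF; apply: (le_trans (irreg_le_quarter _ _ _ _)).
  rewrite ler_wpM2r ?invr_ge0// !card_imset; try exact: perm_inj.
  case/andP: (q_card _ CF) => _ h1; case/andP: (q_card _ DF) => _ h2.
  by rewrite expr2 natr1 ler_pM// ler_nat -addn1.
have -> : irreg_partition R adj [set s @: q C | C in F]
    = \sum_(C in F) \sum_(D in F) irreg R adj (s @: q C) (s @: q D).
  rewrite /irreg_partition big_imset//=; apply: eq_bigr => C _.
  by rewrite big_imset.
apply: (le_trans (sum_pairs_split F0F F0P (fun _ _ => irreg_ge0 _ _ _ _) gb b0)).
have nbad : #|F :\: F0|%:R <= m%:R :> R.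
  by rewrite ler_nat cardsD (setIidPr F0F) leq_subLR cF -P_card.
have hbad : (2%:R * #|F :\: F0|%:R * #|F|%:R + #|F|%:R) * ((k%:R + 1) ^+ 2 / 4%:R)
    <= (2%:R * m%:R * K%:R + K%:R) * ((k%:R + 1) ^+ 2 / 4%:R) :> R.
  by rewrite ler_wpM2r// cF lerD2r ler_wpM2r// ler_wpM2l.
have K8' : 8%:R <= K%:R :> R by rewrite ler_nat.
have Kk' : K%:R * k%:R <= #|T|%:R :> R by rewrite -natrM ler_nat.
have l0 : 0 < l by apply: lt_le_trans l1.
have budget := error_budget alpha_gt0 alpha_lt m1 K8' mK l0 l_sqr ka Kk'.
have := le_trans hs avgS; rewrite /S.
move: hbad budget.
set b := _ / 4%:R; set s1 := \sum_(X in P) _; set p := irreg_partition _ _ _.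
set v := _ / l; set w := (_ * b); set w' := (_ * b).
by clearbody s1 p v w w'; lra.
Qed.
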